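(* Let $\mathbb{K}=\mathbb{F}_s$ be a finite field with $s$ elements, let $N\geq 2$ be an integer, and let $I\subseteq\mathbb{K}[x_0,\ldots,x_N]$ be the homogeneous ideal of all but one of the $\mathbb{K}$-points of $\mathbf{P}^N(\mathbb{K})$. Then $$\rho(I)=\widehat{\rho}(I)=\frac{N(s-1)+1}{s}\quad\text{and}\quad \widehat{\alpha}(I)=s.$$
   Context: Let $R=\mathbb{K}[x_0,\ldots,x_N]$ with its standard grading, and let $(0)\neq I\subsetneq R$ be a homogeneous ideal. The ideal of a finite set $\{p_1,\dots,p_k\}$ of points of $\mathbf{P}^N(\mathbb{K})$ is the ideal generated by all homogeneous polynomials vanishing on the set, i.e. $I=\bigcap_i I_{p_i}$, where $I_{p_i}$ is the ideal of the point $p_i$. Its $m$-th symbolic power is $I^{(m)}=\bigcap_i I_{p_i}^m$. The resurgence of $I$ is $$\rho(I)=\sup\Big\{\frac{m}{r}: I^{(m)}\not\subseteq I^r\Big\},$$ and the asymptotic resurgence of $I$ is $$\widehat{\rho}(I)=\sup\Big\{\frac{m}{r}: I^{(mt)}\not\subseteq I^{rt}\ \text{ for all } t\gg 0\Big\},$$ where $m,r$ range over positive integers. For a nonzero homogeneous ideal $J$, $\alpha(J)$ denotes the least degree of a nonzero homogeneous element of $J$. The Waldschmidt constant of $I$ is $$\widehat{\alpha}(I)=\lim_{m\to\infty}\frac{\alpha(I^{(m)})}{m}=\inf_{m\geq 1}\frac{\alpha(I^{(m)})}{m}$$ (the limit exists and equals the infimum, by subadditivity of $\alpha$ on symbolic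 powers). *)

(* Defs.v *)
From HB Require Import structures.
From mathcomp Require Import all_boot all_order all_algebra.
From mathcomp Require Import mpoly.
From mathcomp Require Import boolp classical_sets reals ereal.
From mathcomp Require Import topology normedtype sequences.

Set Implicit Arguments.
Unset Strict Implicit.
Unset Printing Implicit Defensive.

Import Order.TTheory GRing.Theory Num.Theory.
Import numFieldNormedType.Exports.

Local Open Scope classical_set_scope.
Local Open Scope ring_scope.

Definition ideal_gen (A : comNzRingType) (S : set A) : set A :=
  [set f | exists n (a g : 'I_n -> A),
     (forall i, S (g i)) /\ f = \sum_(i < n) a i * g i].

(* The power 0 is the unit ideal, generated by the empty product. *)
Definition ideal_pow (A : comNzRingType) (I : set A) (m : nat) : set A :=
  ideal_gen [set f | exists g : 'I_m -> A,
     (forall i, I (g i)) /\ f = \prod_(i < m) g i].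

(* The points of P^N(K) are the lines through the origin of K^(N+1). *)
Definition proj_point (K : fieldType) (N : nat) : Type :=
  {L : {vspace 'rV[K]_N.+1} | \dim L == 1%N}.

(* The nonzero vectors of the line are the homogeneous coordinate vectors
   of the point. *)
Definition vanishes_at (K : fieldType) (N : nat)
    (f : {mpoly K[N.+1]}) (p : proj_point K N) : Prop :=
  forall v : 'rV[K]_N.+1, v \in sval p -> v != 0 -> f.@[v 0] = 0.

Definition points_ideal (K : fieldType) (N : nat) (X : set (proj_point K N)) :
    set {mpoly K[N.+1]} :=
  ideal_gen [set f | (exists d : nat, f \is d.-homog) /\
                     forall p, X p -> vanishes_at f p].

(* For finite X this depends only on the ideal I = points_ideal X, since X is
   then the set of common zeros of I in P^N(K); so the invariants of I below
   take X as their argument. *)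
Definition symbolic_pow (K : fieldType) (N : nat) (X : set (proj_point K N))
    (m : nat) : set {mpoly K[N.+1]} :=
  \bigcap_(p in X) ideal_pow (points_ideal [set p]) m.

Definition resurgence (R : realType) (K : fieldType) (N : nat)
    (X : set (proj_point K N)) : \bar R :=
  ereal_sup [set x | exists m r : nat, [/\ (0 < m)%N, (0 < r)%N,
    ~ (symbolic_pow X m `<=` ideal_pow (points_ideal X) r) &
    x = (m%:R / r%:R)%:E]].

Definition asymptotic_resurgence (R : realType) (K : fieldType) (N : nat)
    (X : set (proj_point K N)) : \bar R :=
  ereal_sup [set x | exists m r : nat, [/\ (0 < m)%N, (0 < r)%N,
    (\forall t \near \oo,
       ~ (symbolic_pow X (m * t)%N `<=`
         ideal_pow (points_ideal X) (r * t)%N)) &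
    x = (m%:R / r%:R)%:E]].

(* The default value 0 is taken only when J has no nonzero homogeneous
   element. *)
Definition least_degree (K : fieldType) (n : nat) (J : set {mpoly K[n]}) :
    nat :=
  let has_degree (d : nat) := exists f, [/\ J f, f != 0 & f \is d.-homog] in
  xget 0%N [set d | has_degree d /\ forall e, has_degree e -> (d <= e)%N].

(* [limn] is 0 on a divergent sequence, so that a nonzero value of this
   constant entails the convergence of the sequence. *)
Definition waldschmidt (R : realType) (K : fieldType) (N : nat)
    (X : set (proj_point K N)) : R :=
  limn (fun m : nat => (least_degree (symbolic_pow X m))%:R / m%:R : R).

(* Main.v *)
From HB Require Import structures.
Require Import Defs.
From mathcomp Require Import all_boot all_order all_fingroup all_algebra.
From mathcomp Require Import all_solvable all_field.
From mathcomp Require Import ring zify mpoly.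
From mathcomp Require Import boolp classical_sets reals ereal.
From mathcomp Require Import topology normedtype sequences.

(** Let [s] be the number of elements of [K], let [D = N (s - 1) + 1], and let
    [I] be the ideal of the set [X] of the points other than [q].

    Lower bounds for the resurgences.  A form that vanishes on [X] but not at
    [q] has degree at least [D] ([one_point_degree_geq]): multiplied by a power
    of a variable, a form of smaller degree would still have degree less than
    [(N + 1) (s - 1)], so that its values on [K^(N + 1)] would add up to zero,
    but only the line of [q] contributes to this sum, and its contribution is
    not zero.  Therefore the forms of degree less than [r D] in [I^r] vanish at
    [q].  On the other hand, the
    product [G] of the hyperplanes that avoid [q], each taken [s] times, has
    degree [s^(N + 1)], vanishes to order [s^N] on [X], and does not vanish at
    [q] ([hyperplanes_off_point]).  So [G^t] is in the symbolic power of order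
    [s^N t], but it is not in [I^r] if [s^(N + 1) t < r D], and the fractions
    [s^N t / r] with this property come arbitrarily close to [D / s].

    Waldschmidt constant.  The powers of [G] show that it is at most [s].  It is
    at least [s], because a nonzero form in the symbolic power of order [m] has
    degree at least [s m] ([multiplicity_degree_geq]): the complement of a
    hyperplane through [q] is an affine space all of whose points are in [X],
    and the Schwartz-Zippel bound with multiplicities applies to it.

    Upper bound for the resurgences.  Assume [s m > r D].  By the last bound the
    nonzero homogeneous components of an element of the [m]-th symbolic power
    have degree greater than [r D].  Since [D >= s], also [m > r], and it remains
    to see that the [r]-th symbolic power agrees with [I^r] in degrees at least
    [r D].  This holds for
    all finite sets of points that have separators of degree [D - 1], forms
    [e_y] with value one at the point [y] and zero at the other points
    ([symbolic_pow_large_degree]); for [X] they are given by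
    [separator_exists].  The proof is an elementary form of the theorem that the
    regularity of the [r]-th power of such an ideal is at most [r] times the
    regularity of the ideal.  Let [V] be the space of the forms of degree [D]
    that vanish at the points, and [P] the ideal generated by the products of
    [r] elements of [V].  If [f] is in the [r]-th symbolic power, then all
    [e_y^r f] are in [P].  As every form of degree [D] is modulo [V] a
    combination of separators, multiplied by linear forms, one can descend to
    [f] if [P] has this property of saturation ([ideal_pow_saturated]): a form
    [h] of degree at least [r D] such that all [x_i h] are in [P] is in [P].

    To prove the saturation, adjoin an indeterminate [u] and let
    [L = \sum_i u^i x_i], a linear form that vanishes at no point.  Subtracting
    an interpolation by the [L e_y], and clearing denominators, defines a linear
    map [g |-> c g - \sum_y g(y) c_y L e_y] from forms of degree [D] to [V[u]].
    Cut a monomial of degree greater than [r D] into [r] blocks of degree [D]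
    and a nontrivial rest, and apply this map to the blocks.  Modulo [L P[u]] the
    product of the results does not depend on the choice of the blocks: a
    variable of the rest can be exchanged with a variable of a block
    ([lift_form_swap]), and these transpositions generate all permutations.  So
    there is a linear map [Phi] on the forms of a given degree such that, modulo
    [L P[u]], the image of a monomial is the product obtained from any of its
    cuts.  Modulo [L P[u]], it satisfies [Phi(z) = c^r z] for [z] in [P] and
    [Phi(L h) = 0].  Hence [c^r L h] is in
    [L P[u]], and [c^r h] is in [P[u]], which implies that [h] is in [P]. *)

Set Implicit Arguments.
Unset Strict Implicit.
Unset Printing Implicit Defensive.

Import Order.TTheory GRing.Theory Num.Theory.
Import numFieldNormedType.Exports.

Local Open Scope classical_set_scope.
Local Open Scope ring_scope.

(** * Ideals given by generators *)

Section Ideals.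
Variable A : comNzRingType.
Implicit Types (S T J : set A).

Definition is_ideal J :=
  [/\ J 0, (forall f g, J f -> J g -> J (f + g)) & forall a f, J f -> J (a * f)].

Lemma is_ideal_sum J (I : Type) (s : seq I) (Q : pred I) (F : I -> A) :
  is_ideal J -> (forall i, Q i -> J (F i)) -> J (\sum_(i <- s | Q i) F i).
Proof. by case=> J0 JD _ JF; elim/big_ind: _. Qed.

Lemma is_idealN J f : is_ideal J -> J f -> J (- f).
Proof. by case=> _ _ JM Jf; rewrite -mulN1r; exact: JM. Qed.

Lemma is_idealB J f g : is_ideal J -> J f -> J g -> J (f - g).
Proof. by move=> idJ Jf Jg; case: (idJ) => _ JD _; apply: JD (is_idealN _ _). Qed.

Lemma is_idealMr J f a : is_ideal J -> J f -> J (f * a).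
Proof. by case=> _ _ JM Jf; rewrite mulrC; apply: JM. Qed.

Lemma ideal_gen_is_ideal S : is_ideal (ideal_gen S).
Proof.
split=> [|f g [n [a [u [Su ->]]]] [m [b [v [Sv ->]]]]|b f [n [a [u [Su ->]]]]].
- by exists 0%N, (fun=> 0), (fun=> 0); split=> [[]//|]; rewrite big_ord0.
- exists (n + m)%N, (fun i => match split i with inl j => a j | inr j => b j end),
    (fun i => match split i with inl j => u j | inr j => v j end); split.
    by move=> i; case: (split i).
  rewrite big_split_ord /=; congr (_ + _); apply: eq_bigr => i _.
    by rewrite (unsplitK (inl i : 'I_n + 'I_m)%type).
  by rewrite (unsplitK (inr i : 'I_n + 'I_m)%type).
- exists n, (fun i => b * a i), u; split=> //.
  by rewrite mulr_sumr; apply: eq_bigr => i _; rewrite mulrA.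
Qed.

Lemma sub_ideal_gen S : S `<=` ideal_gen S.
Proof.
by move=> f Sf; exists 1%N, (fun=> 1), (fun=> f); rewrite big_ord1 mul1r.
Qed.

Lemma ideal_gen_min S J : is_ideal J -> S `<=` J -> ideal_gen S `<=` J.
Proof.
move=> idJ SJ f [n [a [u [Su ->]]]]; case: (idJ) => _ _ JM.
by apply: is_ideal_sum => // i _; apply/JM/SJ.
Qed.

Lemma ideal_gen_mul S T J f g : is_ideal J ->
    (forall s t, S s -> T t -> J (s * t)) ->
  ideal_gen S f -> ideal_gen T g -> J (f * g).
Proof.
move=> idJ STJ genf geng; case: (idJ) => J0 JD JM.
suff: ideal_gen S `<=` [set h | J (h * g)] by apply.
apply: ideal_gen_min => [|s Ss /=].
  split=> /= [|f1 f2 J1 J2|a f1 J1]; first by rewrite mul0r.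
    by rewrite mulrDl; apply: JD.
  by rewrite -mulrA; apply: JM.
suff: ideal_gen T `<=` [set h | J (s * h)] by apply.
apply: ideal_gen_min => [|t Tt /=]; last exact: STJ.
split=> /= [|f1 f2 J1 J2|a f1 J1]; first by rewrite mulr0.
  by rewrite mulrDr; apply: JD.
by rewrite mulrCA; apply: JM.
Qed.

Definition products S m : set A :=
  [set f | exists g : 'I_m -> A, (forall i, S (g i)) /\ f = \prod_(i < m) g i].

Lemma products_mul S m1 m2 f g :
  products S m1 f -> products S m2 g -> products S (m1 + m2)%N (f * g).
Proof.
move=> [u [Su ->]] [v [Sv ->]].
exists (fun i => match split i with inl j => u j | inr j => v j end); split.
  by move=> i; case: (split i).
rewrite big_split_ord /=; congr (_ * _); apply: eq_bigr => i _.
  by rewrite (unsplitK (inl i : 'I_m1 + 'I_m2)%type).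
by rewrite (unsplitK (inr i : 'I_m1 + 'I_m2)%type).
Qed.

Lemma products1 S f : S f -> products S 1 f.
Proof. by move=> Sf; exists (fun=> f); rewrite big_ord1. Qed.

Lemma ideal_pow_is_ideal S m : is_ideal (ideal_pow S m).
Proof. exact: ideal_gen_is_ideal. Qed.

Lemma ideal_pow_products S m f : products S m f -> ideal_pow S m f.
Proof. exact: sub_ideal_gen. Qed.

Lemma ideal_pow_prod S m (g : 'I_m -> A) :
  (forall i, S (g i)) -> ideal_pow S m (\prod_(i < m) g i).
Proof. by move=> Sg; apply: ideal_pow_products; exists g. Qed.

Lemma ideal_powM S m1 m2 f g :
  ideal_pow S m1 f -> ideal_pow S m2 g -> ideal_pow S (m1 + m2) (f * g).
Proof.
apply: ideal_gen_mul; first exact: ideal_pow_is_ideal.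
by move=> s t Ss St; apply/ideal_pow_products/products_mul.
Qed.

Lemma ideal_pow1 S f : S f -> ideal_pow S 1 f.
Proof. by move=> Sf; apply/ideal_pow_products/products1. Qed.

Lemma ideal_powX S m f k :
  ideal_pow S m f -> ideal_pow S (m * k) (f ^+ k).
Proof.
move=> Sf; elim: k => [|k IHk]; last by rewrite exprS mulnS; apply: ideal_powM.
rewrite expr0 muln0; apply: ideal_pow_products.
by exists (fun=> 0); rewrite big_ord0; split=> // -[].
Qed.

(** Expand the products of combinations of generators. *)
Lemma ideal_pow_gen S J m : is_ideal J -> products S m `<=` J ->
  ideal_pow (ideal_gen S) m `<=` J.
Proof.
move=> idJ SJ; apply: ideal_gen_min => // _ [g [Sg ->]].
apply: (@ideal_gen_min (products S m) J) => //.
elim: m {SJ} g Sg => [|m IHm] g Sg.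
  by rewrite big_ord0; apply: sub_ideal_gen; exists g; rewrite big_ord0; split=> // -[].
rewrite big_ord_recl.
apply: (ideal_gen_mul _ _ (Sg ord0) (IHm _ (fun i => Sg (lift ord0 i)))).
  exact: ideal_gen_is_ideal.
move=> s t Ss St; apply: sub_ideal_gen.
by rewrite -[m.+1]add1n; apply: products_mul => //; apply: products1.
Qed.

Lemma ideal_powS S T m : S `<=` T -> ideal_pow S m `<=` ideal_pow T m.
Proof.
move=> ST; apply: ideal_gen_min; first exact: ideal_pow_is_ideal.
by move=> _ [g [Sg ->]]; apply: ideal_pow_prod => i; apply/ST/Sg.
Qed.

Lemma ideal_pow_leq S m k : (k <= m)%N -> ideal_pow S m `<=` ideal_pow S k.
Proof.
move=> lekm; apply: ideal_gen_min; first exact: ideal_pow_is_ideal.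
rewrite -(subnKC lekm); move=> _ [g [Sg ->]].
rewrite big_split_ord /=; apply: is_idealMr; first exact: ideal_pow_is_ideal.
by apply: ideal_pow_prod.
Qed.

End Ideals.

Section CoefIdeal.
Variable A : comNzRingType.
Implicit Types (S J : set A).

(** The ideal that [J] generates in the polynomial ring over [A]. *)
Definition coef_ideal J : set {poly A} := [set F | forall k, J F`_k].

Lemma coef_ideal_is_ideal J : is_ideal J -> is_ideal (coef_ideal J).
Proof.
move=> idJ; case: (idJ) => J0 JD JM; split=> /= [k|F G JF JG k|F G JG k].
- by rewrite coef0.
- by rewrite coefD; apply: JD.
- by rewrite coefM; apply: is_ideal_sum => // i _; apply: JM.
Qed.

Lemma coef_ideal_prod S m (F : 'I_m -> {poly A}) :
  (forall i k, S (F i)`_k) -> coef_ideal (ideal_pow S m) (\prod_(i < m) F i).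
Proof.
move=> SF; have idP := coef_ideal_is_ideal (@ideal_pow_is_ideal A S m).
apply: (@ideal_pow_gen _ (polyC @` S) _ m idP); first last.
  apply: ideal_pow_prod => i; rewrite -[F i]coefK poly_def.
  apply: is_ideal_sum => [|k _]; first exact: ideal_gen_is_ideal.
  rewrite -mul_polyC; apply: is_idealMr; first exact: ideal_gen_is_ideal.
  by apply: sub_ideal_gen; exists (F i)`_k.
move=> _ [g [Sg ->]]; have /choice[h hP] i : exists a, S a /\ a%:P = g i.
  by have [a Sa <-] := Sg i; exists a.
rewrite (eq_bigr (fun i => (h i)%:P)) => [|i _]; last by have [] := hP i.
rewrite -rmorph_prod => k; rewrite coefC; case: eqP => _.
  by apply: ideal_pow_prod => i; have [] := hP i.
by case: (@ideal_pow_is_ideal A S m).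
Qed.

End CoefIdeal.

Lemma ideal_pow_rmorph (A B : comNzRingType) (phi : {rmorphism A -> B})
    (S : set A) (T : set B) m f :
  (forall g, S g -> T (phi g)) -> ideal_pow S m f -> ideal_pow T m (phi f).
Proof.
move=> ST [k [a [p [Sp ->]]]]; rewrite rmorph_sum.
apply: is_ideal_sum => [|i _]; first exact: ideal_pow_is_ideal.
rewrite rmorphM; case: (@ideal_pow_is_ideal B T m) => _ _; apply.
by have [g [Sg ->]] := Sp i; rewrite rmorph_prod; apply: ideal_pow_prod => j; apply: ST.
Qed.

(** * Homogeneous components of products *)

Lemma pihomog_mulr (R : nzRingType) (n k e : nat) (a p : {mpoly R[n]}) :
    p \is e.-homog ->
  pihomog mdeg k (a * p) = if (e <= k)%N then pihomog mdeg (k - e) a * p else 0.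
Proof.
move=> hp; rewrite (mpolyE a) mulr_suml !raddf_sum /=.
have -> : (if (e <= k)%N then
    (\sum_(m <- msupp a) pihomog mdeg (k - e) (a@_m *: 'X_[m])) * p else 0) =
  \sum_(m <- msupp a)
    if (e <= k)%N then pihomog mdeg (k - e) (a@_m *: 'X_[m]) * p else 0.
  by case: ifP => _; [rewrite mulr_suml | rewrite big1].
apply: eq_bigr => m _; rewrite -scalerAl !linearZ /= pihomogX.
have hXp : 'X_[m] * p \is (mdeg m + e).-homog by apply: dhomogM; rewrite ?dhomogX.
have [lek|ltk] := leqP e k; last first.
  rewrite (pihomog_ne0 _ hXp) ?scaler0 //; apply: contraTneq ltk => <-.
  by rewrite -leqNgt leq_addl.
case: eqP => [mk|mk].
  by rewrite pihomog_dE -?scalerAl //; move: hXp; rewrite /= mk subnK.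
rewrite (pihomog_ne0 _ hXp) ?(scaler0, mul0r) //.
by apply/eqP => E; apply: mk; rewrite -E addnK.
Qed.
(** * Monomials as products of words of variables *)

Lemma word_of_monomial (n : nat) (J : finType) (S : {set J}) (m : 'X_{1..n.+1}) :
  mdeg m = #|S| -> exists w : J -> 'I_n.+1, (\sum_(j in S) U_(w j))%MM = m.
Proof.
move=> degm; have [k cardS] : exists k, #|S| = k by exists #|S|.
elim: k S m cardS degm => [|k IHk] S m cardS; rewrite cardS => degm.
  exists (fun=> ord0); move/eqP: cardS; rewrite cards_eq0 => /eqP->.
  by rewrite big_set0; move/eqP: degm; rewrite mdeg_eq0 => /eqP.
have /card_gt0P[j jS] : (0 < #|S|)%N by rewrite cardS.
have /existsP[i mi] : [exists i, m i != 0%N].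
  apply: contra_eqT degm => /existsPn m0; rewrite mdegE big1 // => i _.
  by apply/eqP; have := m0 i; rewrite negbK.
have Uim : (U_(i) <= m)%MM by rewrite lep1mP.
have cardSj : #|S :\ j| = k by move: cardS; rewrite (cardsD1 j) jS => -[].
have [|w wE] := IHk (S :\ j) (m - U_(i))%MM cardSj; first rewrite cardSj.
  by apply/eqP; rewrite -eqSS -degm -{2}(submK Uim) mdegD mdeg1 addn1.
exists (fun x => if x == j then i else w x).
rewrite (big_setD1 j) //= eqxx -[RHS](submK Uim) -wE addmC; congr (_ + _)%MM.
by apply: eq_bigr => x; rewrite !inE => /andP[/negPf->].
Qed.

Lemma words_same_monomial (n M : nat) (w w' : 'I_M -> 'I_n) :
    (\sum_j U_(w j))%MM = (\sum_j U_(w' j))%MM ->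
  exists s : 'S_M, forall j, w' j = w (s j).
Proof.
move=> eqm; pose t (v : 'I_M -> 'I_n) := [tuple v j | j < M].
have count_t v a : count_mem a (t v) = (\sum_j U_(v j))%MM a.
  rewrite mnm_sumE -sum1_count big_map big_mkcond /= [LHS]big_enum /=.
  by apply: eq_bigr => j _; rewrite mnm1E; case: eqP.
have /tuple_permP[s ts] : perm_eq (t w') (t w).
  by apply/allP => a _ /=; rewrite !count_t eqm.
exists s => j; have := congr1 (fun u : M.-tuple 'I_n => tnth u j) (val_inj ts).
by rewrite !tnth_mktuple.
Qed.
(** * Interpolation with separators *)

Definition linear_forms_at (R : nzRingType) n (v : 'I_n -> R) : set {mpoly R[n]} :=
  [set l | l \is 1.-homog /\ l.@[v] = 0].

Section Separators.
Variables (K : fieldType) (n d : nat) (Y : finType).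
Variables (pt : Y -> 'I_n.+1 -> K) (e : Y -> {mpoly K[n.+1]}).
Hypothesis pt_neq0 : forall y, exists i, pt y i != 0.
Hypothesis e_homog : forall y, e y \is d.-homog.
Hypothesis e_pt : forall y z, (e y).@[pt z] = (y == z)%:R.

Local Notation S := {mpoly K[n.+1]}.
Local Notation Su := {poly {mpoly K[n.+1]}}.

Definition vanishing_forms : set S :=
  [set f | f \is (d.+1).-homog /\ forall y, f.@[pt y] = 0].
Local Notation V := vanishing_forms.

(** Elements of [Su] are graded by the degree in the variables of [S] alone; the
    indeterminate of [Su] has degree zero. *)
Definition coef_homog (k : nat) (F : Su) := forall i, F`_i \is k.-homog.

Lemma coef_homogM k l F G :
  coef_homog k F -> coef_homog l G -> coef_homog (k + l) (F * G).
Proof.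
by move=> hF hG i; rewrite coefM; apply: rpred_sum => j _; apply: dhomogM.
Qed.

Lemma coef_homogC k f : f \is k.-homog -> coef_homog k f%:P.
Proof. by move=> hf i; rewrite coefC; case: eqP => // _; apply: rpred0. Qed.

Local Notation scal := (map_poly (@mpolyC n.+1 K)).
Local Notation evu y := (map_poly (meval (pt y))).

Lemma coef_homog_scal a : coef_homog 0 (scal a).
Proof.
by move=> i; rewrite coef_map /= -alg_mpolyC; apply: dhomogZ; apply: dhomog1.
Qed.

Lemma evu_scal y a : evu y (scal a) = a.
Proof. by apply/polyP => i; rewrite !coef_map /= mevalC. Qed.

Lemma evu_polyC y (f : S) : evu y f%:P = (f.@[pt y])%:P.
Proof. exact: map_polyC. Qed.

Lemma coef_vanishing F :
  coef_homog d.+1 F -> (forall y, evu y F = 0) -> forall k, V F`_k.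
Proof.
move=> hF F0 k; split=> // y.
by have /polyP/(_ k) := F0 y; rewrite coef_map coef0.
Qed.

(** A linear form that does not vanish at any of the points: over a finite field
    this needs an indeterminate among the coefficients. *)
Definition gen_form : Su := \poly_(i < n.+1) 'X_(inord i).
Local Notation L := gen_form.
Definition gen_val y : {poly K} := \poly_(i < n.+1) pt y (inord i).

Lemma gen_formE : L = \sum_(i < n.+1) ('X_i : S)%:P * 'X^i.
Proof.
by rewrite /L poly_def; apply: eq_bigr => i _; rewrite inord_val mul_polyC.
Qed.

Lemma gen_form_neq0 : L != 0.
Proof.
apply/eqP => /polyP/(_ 0%N); rewrite coef_poly coef0 /= => X0.
have := congr1 (mcoeff U_(inord 0)) X0.
by rewrite mcoeffXU eqxx mcoeff0 => /eqP; rewrite oner_eq0.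
Qed.

Lemma coef_homog_gen_form : coef_homog 1 L.
Proof.
move=> i; rewrite coef_poly; case: ifP => _; last exact: rpred0.
by rewrite dhomogX /= mdeg1.
Qed.

Lemma evu_gen_form y : evu y L = gen_val y.
Proof.
apply/polyP => i; rewrite coef_map !coef_poly /=.
by case: ifP => _; rewrite ?mevalXU // meval0.
Qed.

Lemma gen_val_neq0 y : gen_val y != 0.
Proof.
have [i pi] := pt_neq0 y; apply: contra_neq pi => /polyP/(_ i).
by rewrite coef_poly coef0 ltn_ord inord_val.
Qed.

Definition gen_vals : {poly K} := \prod_y gen_val y.
Definition gen_vals_but y : {poly K} := \prod_(z | z != y) gen_val z.

Lemma gen_vals_neq0 : gen_vals != 0.
Proof. by apply/prodf_neq0 => y _; apply: gen_val_neq0. Qed.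

Lemma gen_vals_butM y : gen_vals_but y * gen_val y = gen_vals.
Proof. by rewrite /gen_vals (bigD1 y) //= mulrC. Qed.

(** Up to the factor [gen_vals], which clears denominators, this is the
    difference of [g] and the form [\sum_y g(y) / L(y) * L * e_y], which has the
    same values as [g] at the points. *)
Definition lift_form (g : S) : Su :=
  scal gen_vals * g%:P -
  \sum_y scal (g.@[pt y] *: gen_vals_but y) * L * (e y)%:P.
Local Notation G := lift_form.

Lemma lift_form_is_additive : additive G.
Proof.
move=> f g; rewrite /G rmorphB mulrBr.
under eq_bigr => y _ do rewrite mevalB scalerBl rmorphB !mulrBl.
rewrite sumrB; ring.
Qed.

HB.instance Definition _ := GRing.isAdditive.Build S Su G lift_form_is_additive.

Lemma lift_formZ a g : G (a *: g) = (a%:MP)%:P * G g.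
Proof.
rewrite /G mulrBr -mul_mpolyC rmorphM mulrCA; congr (_ - _).
rewrite mulr_sumr; apply: eq_bigr => y _; rewrite mevalM mevalC -scalerA.
by rewrite -mul_polyC rmorphM /= map_polyC /= !mulrA.
Qed.

Lemma lift_form_vanishing g :
  (forall y, g.@[pt y] = 0) -> G g = scal gen_vals * g%:P.
Proof.
move=> g0; rewrite /G big1 ?subr0 // => y _.
by rewrite g0 scale0r rmorph0 !mul0r.
Qed.

Lemma lift_form_coef g : g \is (d.+1).-homog -> forall k, V (G g)`_k.
Proof.
move=> hg; apply: coef_vanishing => [i|y].
  rewrite coefB coef_sum; apply: rpredB.
    by rewrite -[d.+1]add0n; apply/coef_homogM/coef_homogC/hg/coef_homog_scal.
  apply: rpred_sum => y _; rewrite -[d.+1]/(0 + 1 + d)%N.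
  apply: coef_homogM; last exact/coef_homogC/e_homog.
  exact/coef_homogM/coef_homog_gen_form/coef_homog_scal.
rewrite rmorphB rmorphM /= evu_scal evu_polyC [X in _ - X]rmorph_sum /=.
rewrite (bigD1 y) //= [X in _ - (_ + X)]big1.
  rewrite addr0 !rmorphM /= evu_scal evu_gen_form evu_polyC e_pt eqxx mulr1.
  by rewrite -scalerAl gen_vals_butM mulrC mul_polyC subrr.
move=> z zy; rewrite rmorphM /= evu_polyC e_pt.
by rewrite (negPf zy) mulr0.
Qed.

(** The terms with [gen_vals] cancel.  What remains is [L] times a combination of
    the products of [e y] with [pt y i *: 'X_j - pt y j *: 'X_i], a linear form
    that vanishes at [pt y]. *)
Lemma lift_form_swap i j g : g \is d.-homog ->
  exists2 W : Su, (forall k, V W`_k) &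
    ('X_i : S)%:P * G ('X_j * g) - ('X_j : S)%:P * G ('X_i * g) = L * W.
Proof.
move=> hg; exists (\sum_y scal (g.@[pt y] *: gen_vals_but y) *
    (e y * (pt y i *: 'X_j - pt y j *: 'X_i))%:P).
  apply: coef_vanishing => [k|z]; last first.
    rewrite [LHS]rmorph_sum big1 //= => y _; rewrite rmorphM /= evu_scal evu_polyC.
    rewrite mevalM e_pt mevalB !mevalZ !mevalXU; case: eqP => [->|_].
      by rewrite (mulrC (pt z j)) subrr mulr0 mulr0.
    by rewrite mul0r mulr0.
  rewrite coef_sum; apply: rpred_sum => y _; rewrite -[d.+1]add0n.
  apply/coef_homogM/coef_homogC; first exact: coef_homog_scal.
  rewrite -(addn1 d); apply: dhomogM; first exact: e_homog.
  by apply: rpredB; apply: dhomogZ; rewrite dhomogX /= mdeg1.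
have rearrange (a b a' b' : Su) : a - b - (a' - b') = (a - a') + (b' - b) by ring.
rewrite /G !mulrBr !mulr_sumr rearrange -sumrB.
rewrite !(rmorphM, rmorphB) /=.
rewrite [X in X + _ = _](_ : _ = 0) ?add0r; last by ring.
apply: eq_bigr => y _; rewrite !mevalM !mevalXU -!scalerA -!mul_mpolyC.
rewrite -!mul_polyC !(rmorphM, rmorphB) /= !map_polyC /=; ring.
Qed.

(** * Multiplication by a generic linear form modulo powers *)

Section Words.
(** A word [w] of length [M] in the variables is cut into [r] blocks of [d.+1]
    letters and a rest, formed by the positions with value [None].  The rest has
    to contain a position [j0], as its letters are exchanged with those of the
    blocks. *)
Variables (M r : nat) (block : 'I_M -> option 'I_r) (j0 : 'I_M).
Hypothesis block_j0 : block j0 = None.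
Hypothesis card_block : forall b, #|[set j | block j == Some b]%SET| = d.+1.

Implicit Type w : 'I_M -> 'I_n.+1.

Definition word_block w o : S := \prod_(j | block j == o) 'X_(w j).

Definition lift_blocks w : Su := \prod_(b < r) G (word_block w (Some b)).

Definition word_lift w : Su := (word_block w None)%:P * lift_blocks w.

Definition gen_form_multiples : set Su :=
  [set F | exists2 Z, coef_ideal (ideal_pow V r) Z & F = L * Z].
Local Notation LP := gen_form_multiples.

Lemma gen_form_multiples_is_ideal : is_ideal LP.
Proof.
have [P0 PD PM] := coef_ideal_is_ideal (@ideal_pow_is_ideal S V r).
split=> [|F F' [Z PZ ->] [Z' PZ' ->]|a F [Z PZ ->]].
- by exists 0; rewrite ?mulr0.
- by exists (Z + Z'); rewrite ?mulrDr //; apply: PD.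
- by exists (a * Z); [apply: PM | rewrite mulrCA].
Qed.
Let idLP := gen_form_multiples_is_ideal.

Lemma word_block_homog w o :
  word_block w o \is #|[set j | block j == o]%SET|.-homog.
Proof.
rewrite /word_block mprodXE dhomogX /= mdeg_sum; under eq_bigr do rewrite mdeg1.
by rewrite sum1dep_card.
Qed.

Lemma eq_word_block w w' o :
  (forall j, block j = o -> w j = w' j) -> word_block w o = word_block w' o.
Proof. by move=> ww'; apply: eq_bigr => j /eqP/ww'->. Qed.

Lemma lift_blocks_in w : coef_ideal (ideal_pow V r) (lift_blocks w).
Proof.
apply: coef_ideal_prod => b; apply: lift_form_coef.
by rewrite -(card_block b); apply: word_block_homog.
Qed.

(** If [j1] is in a block, then the change is a multiple of the change in
    [lift_form_swap], by the rest of the word and by the lifts of the other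
    blocks. *)
Lemma word_lift_swap w j1 : LP (word_lift w - word_lift (w \o tperm j0 j1)).
Proof.
case bj1: (block j1) => [b|]; last first.
  have -> : word_lift (w \o tperm j0 j1) = word_lift w.
    congr (_%:P * _); last first.
      apply: eq_bigr => b _; congr G; apply: eq_word_block => j bj /=.
      by rewrite tpermD //; apply: contra_eq_neq bj => <-; rewrite ?block_j0 ?bj1.
    rewrite /word_block [RHS](reindex_inj (@perm_inj _ (tperm j0 j1))) /=.
    apply: eq_bigl => j /=.
    by case: tpermP => // ->; rewrite ?block_j0 ?bj1.
  by rewrite subrr; case: idLP.
have j10 : j1 != j0 by apply: contra_eq_neq bj1 => ->; rewrite block_j0.
pose restN := \prod_(j | (block j == None) && (j != j0)) ('X_(w j) : S).
pose restb := \prod_(j | (block j == Some b) && (j != j1)) ('X_(w j) : S).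
pose others := \prod_(c < r | c != b) G (word_block w (Some c)).
have others_eq w' : (forall j, j != j0 -> j != j1 -> w' j = w j) ->
  word_lift w' = (restN * 'X_(w' j0))%:P * (G ('X_(w' j1) * restb) * others).
  move=> w'w; congr (_%:P * _).
    rewrite /word_block (bigD1 j0) ?block_j0 //= mulrC; congr (_ * _).
    apply: eq_bigr => j /andP[bj jj0]; rewrite w'w //.
    by apply: contraTneq bj => ->; rewrite bj1.
  rewrite /lift_blocks (bigD1 b) //=; congr (G _ * _).
    rewrite /word_block (bigD1 j1) ?bj1 //=; congr (_ * _).
    apply: eq_bigr => j /andP[bj jj1]; rewrite w'w //.
    by apply: contraTneq bj => ->; rewrite block_j0.
  apply: eq_bigr => c cb; congr G; apply: eq_word_block => j bj.
  apply: w'w; apply: contra_eq_neq bj => ->; rewrite ?block_j0 // bj1.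
  by apply: contra_neq cb => -[].
have restb_homog : restb \is d.-homog.
  rewrite /restb mprodXE dhomogX /= mdeg_sum; under eq_bigr do rewrite mdeg1.
  rewrite sum1dep_card; apply/eqP/succn_inj; rewrite -(card_block b).
  rewrite [RHS](cardsD1 j1) inE bj1 eqxx add1n; congr _.+1.
  by apply: eq_card => j; rewrite !inE andbC.
have [W VW swapE] := lift_form_swap (w j0) (w j1) restb_homog.
rewrite (others_eq w) // (others_eq (w \o tperm j0 j1)) /=; last first.
  by move=> j jj0 jj1 /=; rewrite tpermD // eq_sym.
rewrite tpermL tpermR !rmorphM /=.
exists (restN%:P * (W * others)); last first.
  have factor (a x y g1 g2 o : Su) :
    a * x * (g1 * o) - a * y * (g2 * o) = a * ((x * g1 - y * g2) * o) by ring.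
  by rewrite factor swapE -mulrA mulrCA.
have [_ _ PM] := coef_ideal_is_ideal (@ideal_pow_is_ideal S V r); apply: (PM).
rewrite (_ : W * others =
    \prod_(c < r) if c == b then W else G (word_block w (Some c))).
  apply: coef_ideal_prod => c k; case: eqP => // _.
  by apply: lift_form_coef; rewrite -(card_block c); apply: word_block_homog.
rewrite [RHS](bigD1 b) //= eqxx; congr (_ * _).
by apply: eq_bigr => c /negPf->.
Qed.

(** The transpositions that move [j0] generate the symmetric group. *)
Lemma word_lift_perm w (s : 'S_M) : LP (word_lift w - word_lift (w \o s)).
Proof.
have [_ LPD _] := idLP.
pose stable :=
  [set s : 'S_M | `[< forall w, LP (word_lift w - word_lift (w \o s)) >]]%SET.
suff: s \in stable by rewrite inE => /asboolP; apply.
have stableM : group_set stable.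
  apply/group_setP; split.
    rewrite inE; apply/asboolP => v; rewrite (_ : v \o _ = v) ?subrr; last first.
      by apply/funext => j /=; rewrite perm1.
    by case: idLP.
  move=> s1 s2; rewrite !inE => /asboolP st1 /asboolP st2; apply/asboolP => v.
  rewrite (_ : v \o _ = (v \o s2) \o s1); last first.
    by apply/funext => j /=; rewrite permM.
  by have := LPD _ _ (st2 v) (st1 (v \o s2)); rewrite addrA subrK.
suff /fintype.subsetP sub : <<[set tperm j0 y | y : 'I_M]%SET>>%g \subset stable.
  by apply: sub; rewrite gen_tperm inE.
rewrite (gen_subG _ (group stableM)).
apply/fintype.subsetP => _ /imsetP[y _ ->].
by rewrite inE; apply/asboolP => v; apply: word_lift_swap.
Qed.

Lemma word_lift_monomial w w' :
    (\sum_j U_(w j))%MM = (\sum_j U_(w' j))%MM ->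
  LP (word_lift w - word_lift w').
Proof.
move=> /words_same_monomial[s w'E]; rewrite (_ : w' = w \o s); last exact/funext.
exact: word_lift_perm.
Qed.

Let M_gt0 : (0 < M)%N := leq_ltn_trans (leq0n _) (ltn_ord j0).

(** The default value is taken only when the degree of [m] is not [M]. *)
Definition word_of (m : 'X_{1..n.+1}) : 'I_M -> 'I_n.+1 :=
  odflt [ffun=> ord0]
    [pick w : {ffun 'I_M -> 'I_n.+1} | (\sum_j U_(w j))%MM == m].

Lemma word_ofP m : mdeg m = M -> (\sum_j U_(word_of m j))%MM = m.
Proof.
move=> degm; rewrite /word_of; case: pickP => [w /eqP//|no_w].
have [|w wE] := @word_of_monomial n _ [set: 'I_M]%SET m.
  by rewrite cardsT card_ord.
have := no_w [ffun j => w j]; rewrite -wE => /eqP[].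
by apply: eq_big => [j|j _]; rewrite ?inE ?ffunE.
Qed.

(** The linear map that sends a monomial of degree [M] to the lift of one of its
    words, and that is zero in larger degrees. *)
Definition symmetric_lift (h : S) : Su :=
  \sum_(m : 'X_{1..n.+1 < M.+1}) (h@_m)%:MP%:P * word_lift (word_of m).
Local Notation Phi := symmetric_lift.

Lemma symmetric_lift_is_additive : additive Phi.
Proof.
move=> f g; rewrite /Phi -sumrB; apply: eq_bigr => m _.
by rewrite mcoeffB !rmorphB mulrBl.
Qed.

HB.instance Definition _ :=
  GRing.isAdditive.Build S Su Phi symmetric_lift_is_additive.

Lemma symmetric_liftZ a h : Phi (a *: h) = a%:MP%:P * Phi h.
Proof.
rewrite /Phi mulr_sumr; apply: eq_bigr => m _.
by rewrite mcoeffZ !rmorphM mulrA.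
Qed.

Lemma symmetric_lift_word w :
  LP (word_lift w - Phi (\prod_j 'X_(w j))).
Proof.
rewrite mprodXE; set m := (\sum_j _)%MM.
have degm : mdeg m = M.
  by rewrite mdeg_sum; under eq_bigr do rewrite mdeg1; rewrite sum1_card card_ord.
have ltm : (mdeg m < M.+1)%N by rewrite degm.
rewrite /Phi (bigD1 (BMultinom ltm)) //= big1 ?addr0; last first.
  move=> m' /eqP neq; rewrite mcoeffX; case: eqP => [eqm|_].
    by case: neq; apply: val_inj; rewrite /= -eqm.
  by rewrite !rmorph0 mul0r.
by rewrite mcoeffX eqxx mul1r; apply: word_lift_monomial; rewrite word_ofP.
Qed.

Lemma word_of_blocks (m : option 'I_r -> 'X_{1..n.+1}) :
    (forall o, mdeg (m o) = #|[set j | block j == o]%SET|) ->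
  exists w, forall o, word_block w o = 'X_[m o].
Proof.
move=> degm.
have /choice[v vE] o : exists v : 'I_M -> 'I_n.+1,
    (\sum_(j in [set j | block j == o]%SET) U_(v j))%MM = m o.
  exact: word_of_monomial.
exists (fun j => v (block j) j) => o; rewrite -vE -mprodXE.
by apply: eq_big => [j|j /eqP->//]; rewrite inE.
Qed.

Lemma prod_word_blocks w :
  word_block w None * \prod_(b < r) word_block w (Some b) = \prod_j 'X_(w j).
Proof.
rewrite [RHS](partition_big block predT) //=.
rewrite (bigD1 None) //=; congr (_ * _).
rewrite [RHS](reindex_omap Some id) => [|[]//].
by apply: eq_bigl => b; rewrite /= eqxx.
Qed.

(** Both terms are multilinear in [a] and the [g b], and on monomials they are
    lifts of two words with the same product. *)
Lemma symmetric_lift_prod a (g : 'I_r -> S) :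
    a \is #|[set j | block j == None]%SET|.-homog ->
    (forall b, g b \is (d.+1).-homog) ->
  LP (a%:P * \prod_(b < r) G (g b) - Phi (a * \prod_(b < r) g b)).
Proof.
move=> ha hg; pose k := (msize a + \sum_b msize (g b))%N.
have expand_a : a = \sum_(m : 'X_{1..n.+1 < k}) a@_m *: 'X_[m].
  by apply: mpolywE; rewrite leq_addr.
have expand_g b : g b = \sum_(m : 'X_{1..n.+1 < k}) (g b)@_m *: 'X_[m].
  by apply: mpolywE; rewrite /k (bigD1 b) //= addnCA leq_addr.
have cst (c : 'I_r -> K) : \prod_b (c b)%:MP%:P = (\prod_b c b)%:MP%:P :> Su.
  by rewrite !rmorph_prod.
have -> : a%:P * \prod_(b < r) G (g b) =
    \sum_(m : 'X_{1..n.+1 < k}) \sum_(f : {ffun 'I_r -> 'X_{1..n.+1 < k}})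
      (a@_m * \prod_b (g b)@_(f b))%:MP%:P *
      (('X_[m] : S)%:P * \prod_b G 'X_[f b]).
  rewrite {1}expand_a rmorph_sum mulr_suml; apply: eq_bigr => m _.
  under eq_bigr => b _.
    rewrite (expand_g b) raddf_sum /=; under eq_bigr do rewrite lift_formZ; over.
  rewrite bigA_distr_bigA /= mulr_sumr; apply: eq_bigr => f _.
  by rewrite big_split /= cst -mul_mpolyC polyCM mulrACA mpolyCM polyCM.
have -> : a * \prod_(b < r) g b =
    \sum_(m : 'X_{1..n.+1 < k}) \sum_(f : {ffun 'I_r -> 'X_{1..n.+1 < k}})
      (a@_m * \prod_b (g b)@_(f b)) *: ('X_[m] * \prod_b 'X_[f b]).
  rewrite {1}expand_a mulr_suml; apply: eq_bigr => m _.
  under eq_bigr => b _ do rewrite (expand_g b).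
  rewrite bigA_distr_bigA /= mulr_sumr; apply: eq_bigr => f _.
  by rewrite scaler_prod -scalerAl -scalerAr scalerA.
rewrite [X in _ - X]raddf_sum -sumrB; apply: is_ideal_sum => // m _.
rewrite [X in _ - X]raddf_sum -sumrB; apply: is_ideal_sum => // f _.
rewrite /= symmetric_liftZ -mulrBr; case: (idLP) => LP0 _ LPM.
have [am|/(dhomog_nemf_coeff ha)->] :=
  eqVneq (mdeg m) #|[set j | block j == None]%SET|; last by rewrite mul0r !rmorph0 mul0r.
have [/forallP gf|] := boolP [forall b, mdeg (f b) == d.+1]; last first.
  case/forallPn => b /(dhomog_nemf_coeff (hg b)) gb0.
  by rewrite (bigD1 b) //= gb0 mul0r mulr0 !rmorph0 mul0r.
apply: LPM.
have [[b|]//=|w wE] := @word_of_blocks (fun o => if o is Some b then f b else m).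
  by rewrite card_block; apply/eqP/gf.
rewrite -(wE None) -(eq_bigr _ (fun b _ => wE (Some b))) prod_word_blocks.
rewrite -(eq_bigr _ (fun b _ => congr1 G (wE (Some b)))).
exact: symmetric_lift_word.
Qed.

(** Lifting is multiplication by [gen_vals] on the elements of [V]. *)
Lemma symmetric_lift_pow z : z \is M.-homog -> ideal_pow V r z ->
  LP (scal gen_vals ^+ r * z%:P - Phi z).
Proof.
move=> hz [k [a [p [Vp zE]]]].
have {hz zE} -> : z = \sum_(i < k) pihomog mdeg M (a i * p i).
  by rewrite -[LHS](pihomog_dE hz) zE raddf_sum.
rewrite rmorph_sum [Phi _]raddf_sum mulr_sumr -sumrB; apply: is_ideal_sum => // i _.
have [v [Vv ->]] := Vp i.
have hv : \prod_(b < r) v b \is (\sum_(b < r) d.+1).-homog.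
  by elim/big_rec2: _ => [|b m f _ hf]; [exact: dhomog1 | apply/dhomogM; case: (Vv b)].
rewrite /= (pihomog_mulr _ _ hv); case: leqP => [le_rM|_]; last first.
  by rewrite !raddf0 mulr0 addr0; case: idLP.
have card_None : #|[set j | block j == None]%SET| = (M - \sum_(b < r) d.+1)%N.
  apply: (canRL (addnK _)); rewrite -[RHS]card_ord -[RHS]sum1_card.
  rewrite [RHS](partition_big block predT) //= [RHS](bigD1 None) //=.
  congr (_ + _)%N; first by rewrite sum1dep_card.
  rewrite [RHS](reindex_omap Some id) => [|[]//].
  by apply: eq_big => [b|b _]; rewrite /= ?eqxx // sum1dep_card card_block.
have := @symmetric_lift_prod (pihomog mdeg (M - \sum_(b < r) d.+1) (a i)) v.
rewrite card_None pihomogP => /(_ isT (fun b => (Vv b).1)).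
rewrite (eq_bigr (fun b => scal gen_vals * (v b)%:P)) => [|b _]; last first.
  by apply: lift_form_vanishing => y; case: (Vv b).
rewrite big_split /= prodr_const card_ord mulrCA -rmorph_prod -rmorphM.
by [].
Qed.

(** The elements [scal gen_vals ^+ r * (L * h)] and [Phi (L * h)] are congruent
    modulo [LP] since all ['X_i * h] are in the power of [V].  The second one is
    in [LP] because the rest of a word of ['X_i * 'X_[m]] can be chosen to
    contain the factor ['X_i], while its other letters do not depend on [i]. *)
Lemma ideal_pow_colon h : h \is (M.-1).-homog ->
  (forall i, ideal_pow V r ('X_i * h)) -> ideal_pow V r h.
Proof.
move=> hh Pxh; case: (idLP) => LP0 LPD LPM.
have [_ _ PM] := coef_ideal_is_ideal (@ideal_pow_is_ideal S V r).
have lift_linear : LP (\sum_(i < n.+1) 'X^i * Phi ('X_i * h)).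
  have Phi_xh i : Phi ('X_i * h) =
      \sum_(m <- msupp h) (h@_m)%:MP%:P * Phi ('X_i * 'X_[m]).
    rewrite [X in _ * X]mpolyE mulr_sumr [LHS]raddf_sum.
    by apply: eq_bigr => m _; rewrite -scalerAr /= symmetric_liftZ.
  have -> : \sum_(i < n.+1) 'X^i * Phi ('X_i * h) =
      \sum_(m <- msupp h) (h@_m)%:MP%:P *
        \sum_(i < n.+1) 'X^i * Phi ('X_i * 'X_[m]).
    under [RHS]eq_bigr do rewrite mulr_sumr; rewrite [RHS]exchange_big.
    apply: eq_bigr => i _; rewrite Phi_xh mulr_sumr.
    by apply: eq_bigr => m _; rewrite mulrCA.
  apply: is_ideal_sum => // m _.
  have [hm|/(dhomog_nemf_coeff hh)->] := eqVneq (mdeg m) M.-1;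
    last by rewrite !rmorph0 mul0r.
  apply: (LPM); have [|w wE] := @word_of_monomial n _ [set~ j0]%SET m.
    by rewrite cardsC1 card_ord.
  pose w_ i j := if j == j0 then i else w j.
  pose rest i := (\prod_(j | (block j == None) && (j != j0)) ('X_(w_ i j) : S))%:P *
    lift_blocks (w_ i).
  have rest_const i : rest i = rest ord0.
    congr (_%:P * _).
      by apply: eq_bigr => j /andP[_ /negPf jj0]; rewrite /w_ jj0.
    apply: eq_bigr => b _; congr G; apply: eq_word_block => j bj.
    by rewrite /w_; case: eqP => // jj0; rewrite jj0 block_j0 in bj.
  have Phi_w i : LP (('X_i : S)%:P * rest ord0 - Phi ('X_i * 'X_[m])).
    rewrite -(rest_const i) /rest mulrA -rmorphM /=.
    have -> : ('X_i : S) * \prod_(j | (block j == None) && (j != j0)) 'X_(w_ i j) =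
        word_block (w_ i) None.
      by rewrite /word_block [RHS](bigD1 j0) ?block_j0 //= {2}/w_ eqxx.
    rewrite -wE -mprodXE.
    have -> : ('X_i : S) * \prod_(j in [set~ j0]%SET) 'X_(w j) = \prod_j 'X_(w_ i j).
      rewrite [RHS](bigD1 j0) //= {1}/w_ eqxx; congr (_ * _).
      apply: eq_big => [j|j jj0]; first by rewrite !inE.
      by move: jj0; rewrite !inE /w_ => /negPf->.
    exact: symmetric_lift_word.
  have : LP (L * rest ord0).
    exists (rest ord0) => //; apply/PM/lift_blocks_in.
  move=> LPL; rewrite -[X in LP X](subKr (L * rest ord0)); apply: is_idealB => //.
  rewrite gen_formE mulr_suml -sumrB; apply: is_ideal_sum => // i _.
  by rewrite [_ * 'X^i]mulrC -mulrA -mulrBr; apply/LPM/Phi_w.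
have [Z PZ LZ] : LP (scal gen_vals ^+ r * (L * h%:P)).
  rewrite -[X in LP X](subrK (\sum_(i < n.+1) 'X^i * Phi ('X_i * h))).
  apply: LPD => //; rewrite gen_formE mulr_suml mulr_sumr -sumrB.
  apply: is_ideal_sum => // i _.
  have hxh : 'X_i * h \is M.-homog.
    by rewrite -(prednK M_gt0) -[_.-1.+1]add1n dhomogM // dhomogX /= mdeg1.
  have := LPM 'X^i _ (symmetric_lift_pow hxh (Pxh i)).
  rewrite mulrBr rmorphM; congr (LP (_ - _)).
  by rewrite [_ * 'X^i]mulrC -mulrA [RHS]mulrCA.
have {LZ} ZE : scal gen_vals ^+ r * h%:P = Z.
  by apply: (mulfI gen_form_neq0); rewrite -LZ mulrCA.
have lead_neq0 : lead_coef (gen_vals ^+ r) != 0.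
  by rewrite lead_coef_eq0 expf_neq0 // gen_vals_neq0.
(* A nonzero constant multiple of [h] is a coefficient of [Z]. *)
have := PZ (size (gen_vals ^+ r)).-1; rewrite -ZE -rmorphXn coefMC coef_map /=.
rewrite -/(lead_coef _); case: (@ideal_pow_is_ideal S V r) => _ _ PM'.
move=> /(PM' (lead_coef (gen_vals ^+ r))^-1%:MP).
by rewrite mulrA -mpolyCM mulVf // mpolyC1 mul1r.
Qed.

End Words.

(** * Symbolic powers in large degrees *)

Lemma ideal_pow_saturated r t h : (r * d.+1 <= t)%N -> h \is t.-homog ->
  (forall i, ideal_pow V r ('X_i * h)) -> ideal_pow V r h.
Proof.
move=> le_rt hh Pxh.
(* The blocks are the first intervals of length [d.+1]; positions from
   [r * d.+1] on have a quotient that is not in ['I_r]. *)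
pose block (j : 'I_t.+1) : option 'I_r := insub (j %/ d.+1)%N.
apply: (@ideal_pow_colon t.+1 r block ord_max) => //.
  by rewrite /block insubN // -leqNgt leq_divRL.
move=> b; have lt_bt (i : 'I_d.+1) : (b * d.+1 + i < t.+1)%N.
  rewrite ltnS; apply: leq_trans le_rt; apply: leq_trans (_ : b.+1 * d.+1 <= _)%N.
    by rewrite mulSn addnC leq_add2r ltnW.
  by rewrite leq_mul2r ltn_ord orbT.
rewrite -[RHS]card_ord -(@card_imset _ _ (fun i => Ordinal (lt_bt i))); last first.
  by move=> i i' /(congr1 val)/= /addnI/val_inj.
apply: eq_card => j; rewrite inE; apply/eqP/imsetP => [|[i _ ->]]; last first.
  by rewrite /block /= divnMDl // divn_small // addn0 valK.
rewrite /block; case: insubP => // b' _ b'E [b'b].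
exists (Ordinal (ltn_pmod j (isT : 0 < d.+1)%N)) => //.
by apply: val_inj; rewrite /= -b'b b'E -divn_eq.
Qed.

Lemma linear_form_at y : exists2 l : S, l \is 1.-homog & l.@[pt y] = 1.
Proof.
have [i pi] := pt_neq0 y; exists ((pt y i)^-1 *: 'X_i).
  by apply: dhomogZ; rewrite dhomogX /= mdeg1.
by rewrite mevalZ mevalXU mulVf.
Qed.

(** Modulo [V], every form of degree [d.+1] is a combination of products of
    linear forms with separators.  So [z] is multiplied into the ideal by all
    monomials of degree [d.+1], and then, one degree at a time by
    [ideal_pow_saturated], by all monomials of smaller degree. *)
Lemma ideal_pow_separators r t z : (r * d.+1 <= t)%N -> z \is t.-homog ->
    (forall v, V v -> ideal_pow V r (v * z)) ->
    (forall y, ideal_pow V r (e y * z)) ->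
  ideal_pow V r z.
Proof.
move=> le_rt hz Vz ez; have [_ PD PM] := @ideal_pow_is_ideal S V r.
suff Xz k m : (mdeg m + k = d.+1)%N -> ideal_pow V r ('X_[m] * z).
  by have := Xz d.+1 0%MM; rewrite mdeg0 mpolyX0 mul1r; apply.
elim: k m => [|k IHk] m degm; last first.
  apply: (@ideal_pow_saturated _ (mdeg m + t)); first exact: leq_trans (leq_addl _ _).
    by apply: dhomogM => //; rewrite dhomogX.
  move=> i; rewrite mulrA -mpolyXD; apply: IHk.
  by rewrite mdegD mdeg1 -addnA add1n -addnS.
have /choice[l lP] y : exists l : S, l \is 1.-homog /\ l.@[pt y] = 1.
  by have [l] := linear_form_at y; exists l.
pose c : S := \sum_y ('X_[m]).@[pt y] *: (l y * e y).
rewrite -(subrK c 'X_[m]) mulrDl; apply: PD; last first.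
  rewrite mulr_suml; apply: is_ideal_sum => [|y _]; first exact: ideal_pow_is_ideal.
  by rewrite -mul_mpolyC -!mulrA; do 2!apply: (PM).
apply: Vz; split=> [|y].
  apply: rpredB; first by rewrite dhomogX /= -degm addn0.
  apply: rpred_sum => y _; apply: dhomogZ; rewrite -(add1n d); apply: dhomogM => //.
  by case: (lP y).
rewrite mevalB [X in _ - X]raddf_sum /= (bigD1 y) //= big1 => [|y' y'y].
  by rewrite addr0 mevalZ mevalM e_pt eqxx (lP y).2 !mulr1 subrr.
by rewrite mevalZ mevalM e_pt (negPf y'y) !mulr0.
Qed.

Lemma separatorM y l : linear_forms_at (pt y) l -> V (e y * l).
Proof.
move=> [hl ly]; split=> [|z]; first by rewrite -(addn1 d); apply: dhomogM.
rewrite mevalM e_pt; case: eqP => [<-|_]; first by rewrite ly mulr0.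
by rewrite mul0r.
Qed.

Lemma separatorXM r y f :
  ideal_pow (linear_forms_at (pt y)) r f -> ideal_pow V r (e y ^+ r * f).
Proof.
have [P0 PD PM] := @ideal_pow_is_ideal S V r.
apply: (@ideal_gen_min _ _ [set f | ideal_pow V r (e y ^+ r * f)]).
  split=> /= [|f1 f2|a f1]; rewrite ?mulr0 // ?mulrDr; first exact: PD.
  by rewrite mulrCA; apply: PM.
move=> _ [l [ly ->]] /=; rewrite -[r in e y ^+ r]card_ord -prodr_const -big_split /=.
by apply: ideal_pow_prod => i; apply: separatorM.
Qed.

(** Products of at least [r] factors in [V], or of separators with at least [r]
    equal factors, multiply [f] into the power of [V].  By
    [ideal_pow_separators] this descends to products with fewer factors, and
    finally to [f]. *)
Lemma symbolic_pow_large_degree r t f : (r * d.+1 <= t)%N -> f \is t.-homog ->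
  (forall y, ideal_pow (linear_forms_at (pt y)) r f) -> ideal_pow V r f.
Proof.
move=> le_rt hf ptf; have idP := @ideal_pow_is_ideal S V r; have [_ _ PM] := idP.
(* [k] bounds the number of factors that are missing for a product which
   multiplies [f] into the power for one of these reasons. *)
suff main k (a : Y -> nat) (b : nat) g : ideal_pow V b g ->
    g \is (b * d.+1).-homog -> (\sum_y (r - a y) + (r - b) <= k)%N ->
    ideal_pow V r (\prod_y e y ^+ a y * g * f).
  have := main _ (fun=> 0%N) 0%N 1 _ _ (leqnn _).
  rewrite big1 // !mul1r; apply; last exact: dhomog1.
  by apply: ideal_pow_products; exists (fun=> 0); rewrite big_ord0; split=> // -[].
elim: k a b g => [|k IHk] a b g Vg hg.
  rewrite leqn0 addn_eq0 => /andP[_]; rewrite subn_eq0 => le_rb.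
  rewrite mulrAC; apply: (PM); exact: ideal_pow_leq Vg.
move=> le_k; have [le_rb|lt_br] := leqP r b.
  by rewrite mulrAC; apply: (PM); exact: ideal_pow_leq Vg.
have [/existsP[y le_ra]|/existsPn small] := boolP [exists y, (r <= a y)%N].
  rewrite (bigD1 y) //= -(subnKC le_ra) exprD.
  set u := e y ^+ r; set v := _ ^+ _; set w := \prod_(_ | _) _.
  have -> : u * v * w * g * f = v * w * g * (u * f) by ring.
  by apply/PM/separatorXM.
have [tt htt] : exists D, \prod_y e y ^+ a y * g \is D.-homog.
  have [D hD] : exists D, \prod_y e y ^+ a y \is D.-homog.
    elim/big_rec: _ => [|y p _ [D hp]]; first by exists 0%N; apply: dhomog1.
    by exists (d * a y + D)%N; apply: dhomogM => //; apply: dhomogMn.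
  by exists (D + b * d.+1)%N; apply: dhomogM.
apply: (@ideal_pow_separators _ (tt + t)) => [||v Vv|y].
- exact: leq_trans (leq_addl _ _).
- exact: dhomogM.
- have -> : v * (\prod_y e y ^+ a y * g * f) = \prod_y e y ^+ a y * (v * g) * f by ring.
  apply: (IHk a b.+1).
  + by rewrite -(add1n b); apply: ideal_powM => //; apply: ideal_pow1.
  + by rewrite (mulSn b d.+1); apply: dhomogM => //; case: Vv.
  + by move: le_k; rewrite -(subnSK lt_br) addnS ltnS.
- have -> : e y * (\prod_y e y ^+ a y * g * f) =
      \prod_z e z ^+ (a z + (z == y)) * g * f.
    rewrite [in RHS](bigD1 y) //= eqxx addn1 exprS (bigD1 y) //=.
    rewrite [in RHS](eq_bigr (fun z => e z ^+ a z)) => [|z /negPf->].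
      by rewrite !mulrA.
    by rewrite addn0.
  apply: (IHk (fun z => a z + (z == y))%N b) => //.
  rewrite -ltnS; apply: leq_trans le_k; rewrite ltn_add2r.
  have lt_ar : (a y < r)%N by rewrite ltnNge small.
  rewrite (bigD1 y) //= [X in (_ < X)%N](bigD1 y) //= eqxx addn1 -(subnSK lt_ar).
  rewrite addSn ltnS leq_add2l; apply: leq_sum => z /negPf->.
  by rewrite addn0.
Qed.
End Separators.

(** * Schwartz-Zippel with multiplicities *)

Section ModuloIdeal.
Variables (K : fieldType) (A : comNzRingType) (c : {rmorphism K -> A}).
Implicit Types (J : set A) (P Q : {poly K}) (F : {poly A}).

Local Notation ext P := (map_poly c P).

Definition congruent_multiple J P : set {poly A} :=
  [set F | exists B, coef_ideal J (F - ext P * B)].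

(** As in the Chinese remainder theorem, with the coefficients of a Bezout
    relation between [P] and [Q]. *)
Lemma congruent_multiple_coprime J P Q F : is_ideal J -> coprimep P Q ->
  congruent_multiple J P F -> congruent_multiple J Q F ->
  congruent_multiple J (P * Q) F.
Proof.
move=> /coef_ideal_is_ideal[J0 JD JM] /Bezout_eq1_coprimepP[[u w] /= uPwQ].
move=> [B FB] [C FC]; exists (ext u * C + ext w * B).
have {uPwQ} uPwQ : ext u * ext P + ext w * ext Q = 1.
  by rewrite -!rmorphM -rmorphD uPwQ rmorph1.
have -> : F - ext (P * Q) * (ext u * C + ext w * B) =
    ext u * ext P * (F - ext Q * C) + ext w * ext Q * (F - ext P * B).
  rewrite rmorphM -{1}[F]mul1r -uPwQ; ring.
by apply: (JD); apply: (JM).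
Qed.

Lemma congruent_multiple_prod J F k (s : seq K) : is_ideal J -> uniq s ->
    {in s, forall a, congruent_multiple J (('X - a%:P) ^+ k) F} ->
  congruent_multiple J (\prod_(a <- s) ('X - a%:P) ^+ k) F.
Proof.
move=> idJ; elim: s => [|a s IHs] /=.
  rewrite big_nil => _ _; exists F; rewrite rmorph1 mul1r subrr.
  by case: (coef_ideal_is_ideal idJ).
move=> /andP[as_ us] sF; rewrite big_cons; apply: congruent_multiple_coprime => //.
- rewrite coprimep_expl // coprimep_sym coprimep_XsubC rootE horner_prod.
  rewrite prodf_seq_neq0; apply/allP => b bs /=; rewrite horner_exp hornerXsubC.
  by rewrite expf_neq0 // subr_eq0; apply: contraNneq as_ => ->.
- by apply: sF; rewrite mem_head.
- by apply: IHs => // b bs; apply: sF; rewrite in_cons bs orbT.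
Qed.

(** The multiple of [P] has larger degree than [F], so that its leading
    coefficient, which is that of the other factor, has to lie in [J]. *)
Lemma coef_ideal_small J P F : is_ideal J -> P \is monic ->
  (size F < size P)%N -> congruent_multiple J P F -> coef_ideal J F.
Proof.
move=> idJ Pmon ltFP [B]; have [J0 JD JM] := coef_ideal_is_ideal idJ.
have [k leBk] := ubnP (size B); elim: k B leBk => // k IHk B leBk FB.
have [B0|B_neq0] := eqVneq B 0; first by rewrite -[F]subr0 -(mulr0 (ext P)) -B0.
have ePmon : ext P \is monic by apply: monic_map.
have sizeP : size (ext P) = size P.
  by apply: size_map_poly_id0; rewrite (monicP Pmon) rmorph1 oner_eq0.
have JB : J (lead_coef B).
  have F0 : F`_(size (B * ext P)).-1 = 0.
    apply: nth_default; rewrite size_Mmonic // sizeP -ltnS.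
    apply: leq_trans ltFP _.
    have : (0 < size P)%N by rewrite size_poly_gt0 monic_neq0.
    have := B_neq0; rewrite -size_poly_gt0; lia.
  have := FB (size (B * ext P)).-1; rewrite coefB F0 sub0r => /(is_idealN idJ).
  by rewrite opprK [ext P * B]mulrC -(lead_coef_Mmonic _ ePmon).
pose B' := B - (lead_coef B) *: 'X^((size B).-1).
apply: (IHk B'); last first.
  rewrite (_ : F - ext P * B' =
      (F - ext P * B) + ext P * (lead_coef B *: 'X^((size B).-1))).
    apply: JD => //; apply: JM => i; rewrite coefZ; case: (idJ) => _ _ JM'.
    by rewrite mulrC; apply: JM'.
  rewrite /B'; ring.
suff : (size B' <= (size B).-1)%N.
  by move: B_neq0 leBk; rewrite -size_poly_gt0; lia.
apply/leq_sizeP => i; rewrite leq_eqVlt => /orP[/eqP<-|lti].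
  by rewrite /B' coefB coefZ coefXn eqxx mulr1 /lead_coef subrr.
rewrite /B' coefB coefZ coefXn gtn_eqF // mulr0 subr0 nth_default //.
by move: lti; case: (size B).
Qed.

End ModuloIdeal.

Lemma mcoeff_muni (R : comNzRingType) (n : nat) (f : {mpoly R[n.+1]})
    (m : 'X_{1..n.+1}) :
  (muni f)`_(m ord_max)@_[multinom m (widen_ord (leqnSn n) i) | i < n] = f@_m.
Proof.
rewrite muniE coef_sum raddf_sum [in RHS](mpolyE f) raddf_sum /=.
apply: eq_bigr => m' _; rewrite coefZ mcoeffZ coefXn mcoeffX.
case: eqP => [emax|nemax]; last first.
  rewrite mulr0 mcoeff0; case: eqP => [E|_]; last by rewrite mulr0.
  by case: nemax; rewrite E.
rewrite mulr1 mcoeffZ mcoeffX; congr (_ * _%:R); congr nat_of_bool.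
apply/eqP/eqP => [/mnmP E|->//]; apply/mnmP => i.
have [lti|] := ltnP i n; last first.
  move=> lei; have -> // : i = ord_max.
  by apply/val_inj/eqP; rewrite eqn_leq -ltnS ltn_ord.
have := E (Ordinal lti); rewrite !mnmE; congr (_ = _); congr (_ _); exact: val_inj.
Qed.

Lemma muni_neq0 (R : comNzRingType) (n : nat) (f : {mpoly R[n.+1]}) :
  f != 0 -> muni f != 0.
Proof.
apply: contra_neq => f0; apply/mpolyP => m.
by rewrite -mcoeff_muni f0 coef0 !mcoeff0.
Qed.

Lemma coef_muni_homog (R : comNzRingType) (n d k : nat) (f : {mpoly R[n.+1]}) :
    f \is d.-homog -> (muni f)`_k != 0 ->
  (k <= d)%N /\ (muni f)`_k \is (d - k).-homog.
Proof.
move=> hf; have key a : (muni f)`_k@_a != 0 -> (mdeg a + k = d)%N.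
  pose m := (mnmwiden a + U_(ord_max) *+ k)%MM.
  have mk : m ord_max = k.
    by rewrite mnmDE mnmwiden_ordmax mulmnE mnm1E eqxx mul1n.
  have ma : [multinom m (widen_ord (leqnSn n) i) | i < n] = a.
    apply/mnmP => i; rewrite mnmE mnmDE mnmwiden_widen mulmnE mnm1E.
    by rewrite -val_eqE /= gtn_eqF // addn0.
  rewrite -{1}mk -{1}ma mcoeff_muni => fm.
  have := dhomog_mf hf (_ : m \in msupp f); rewrite mcoeff_msupp fm => /(_ isT) /= <-.
  rewrite -ma mdegE [in RHS]mdegE big_ord_recr /= mk; congr (_ + _)%N.
  by apply: eq_bigr => i _; rewrite mnmE.
move=> fk; have /key <- : (muni f)`_k@_(mlead (muni f)`_k) != 0 by rewrite mleadc_eq0.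
split; first exact: leq_addl.
rewrite addnK; apply/dhomogP => a; rewrite mcoeff_msupp => /key.
have /key <- : (muni f)`_k@_(mlead (muni f)`_k) != 0 by rewrite mleadc_eq0.
by move/addIn.
Qed.

Lemma rmorph_mod_ideal (R : comNzRingType) (A : comNzRingType) (n : nat)
    (phi psi : {rmorphism {mpoly R[n]} -> A}) (J : set A) :
    is_ideal J -> (forall c, phi c%:MP = psi c%:MP) ->
    (forall i, J (phi 'X_i - psi 'X_i)) ->
  forall f, J (phi f - psi f).
Proof.
move=> idJ eqC eqX; have [J0 JD JM] := idJ.
have eqM f g : J (phi f - psi f) -> J (phi g - psi g) ->
    J (phi (f * g) - psi (f * g)).
  move=> Jf Jg; rewrite !rmorphM.
  have -> : phi f * phi g - psi f * psi g =
      phi g * (phi f - psi f) + psi f * (phi g - psi g) by ring.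
  by apply: JD; apply: JM.
move=> f; rewrite (mpolyE f) !rmorph_sum -sumrB.
apply: is_ideal_sum => // m _; rewrite -mul_mpolyC; apply: (eqM).
  by rewrite eqC subrr.
rewrite mpolyXE_id; elim/big_ind: _ => [|f1 f2|i _]; first by rewrite !rmorph1 subrr.
  exact: eqM.
elim: (m i) => [|k IHk]; first by rewrite expr0 !rmorph1 subrr.
by rewrite exprS; apply: eqM.
Qed.

Section PointMultiplicity.
Variable K : fieldType.

(** Generators of the maximal ideal of the point [v] of affine space. *)
Definition point_gens n (v : 'I_n -> K) : set {mpoly K[n]} :=
  [set f | exists i, f = 'X_i - (v i)%:MP].

Lemma ideal_gen_point n (v : 'I_n -> K) f :
  ideal_gen (point_gens v) (f - (f.@[v])%:MP).
Proof.
pose c : {rmorphism {mpoly K[n]} -> {mpoly K[n]}} := (@mpolyC n K \o meval v).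
apply: (@rmorph_mod_ideal _ _ _ idfun c).
- exact: ideal_gen_is_ideal.
- by move=> a; rewrite /= mevalC.
- by move=> i; rewrite /= mevalXU; apply: sub_ideal_gen; exists i.
Qed.

Lemma ideal_pow_point n (v : 'I_n -> K) S m f :
    (forall g, S g -> g.@[v] = 0) -> ideal_pow S m f ->
  ideal_pow (point_gens v) m f.
Proof.
move=> Sv Sf; apply: (@ideal_pow_gen _ (point_gens v)).
- exact: ideal_pow_is_ideal.
- exact: ideal_pow_products.
- apply: ideal_powS Sf => g /Sv gv.
  by have := ideal_gen_point v g; rewrite gv mpolyC0 subr0.
Qed.

Lemma products_adjoin (A : comNzRingType) (S : set A) (x : {poly A}) m F :
    products (polyC @` S `|` [set x]) m F ->
  exists c p, [/\ (c <= m)%N, products S (m - c) p & F = x ^+ c * p%:P].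
Proof.
case=> g [Sg ->]; elim: m g Sg => [|m IHm] g Sg.
  exists 0%N, 1; split=> //; last by rewrite big_ord0 mulr1.
  by exists (fun=> 0); rewrite big_ord0; split=> // -[].
have [c [p [lecm Sp pE]]] := IHm _ (fun i => Sg (lift ord0 i)).
rewrite big_ord_recl pE; case: (Sg ord0) => [[a Sa <-]|->].
  exists c, (a * p); split; first exact: leqW.
    by rewrite subSn // -(add1n (m - c)); apply: products_mul => //; apply: products1.
  by rewrite mulrCA rmorphM.
by exists c.+1, p; rewrite exprS mulrA subSS.
Qed.

(** A polynomial that vanishes to order [m] at [(v, a)] vanishes, modulo the
    polynomials in the first variables of order [k] at [v], to order [m - k + 1]
    at [a] in the last variable. *)
Lemma congruent_multiple_muni n (f : {mpoly K[n.+1]}) (v : 'I_n -> K) a m k :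
    (k <= m)%N ->
    (forall w : 'I_n.+1 -> K, (forall i, w (widen_ord (leqnSn n) i) = v i) ->
       w ord_max = a -> ideal_pow (point_gens w) m f) ->
  congruent_multiple (@mpolyC n K) (ideal_pow (point_gens v) k)
    (('X - a%:P) ^+ (m - k).+1) (muni f).
Proof.
move=> lekm ptf.
pose w (i : 'I_n.+1) := if split (cast_ord (esym (addn1 n)) i) is inl j then v j else a.
have w_widen i : w (widen_ord (leqnSn n) i) = v i.
  rewrite /w; case: splitP => [j eq|j]; first by congr v; apply: val_inj.
  by rewrite ord1 /= addn0 => /eqP; rewrite ltn_eqF.
have w_max : w ord_max = a.
  rewrite /w; case: splitP => // j /= E.
  by have := ltn_ord j; rewrite -E ltnn.
pose T : set {poly {mpoly K[n]}} := polyC @` point_gens v `|` [set 'X - a%:MP%:P].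
have : ideal_pow T m (muni f).
  apply: ideal_pow_rmorph (ptf w w_widen w_max) => _ [i ->].
  rewrite rmorphB /= muniC /w.
  have -> : muni ('X_i : {mpoly K[n.+1]}) =
      if split (cast_ord (esym (addn1 n)) i) is inl j then ('X_j)%:P else 'X.
    by rewrite /muni mmapX mmap1U.
  case: split => [j|_]; last by right.
  by left; exists ('X_j - (v j)%:MP); [exists j | rewrite rmorphB].
case=> [x [u [p [Tp ->]]]].
have [J0 JD JM] := coef_ideal_is_ideal (@ideal_pow_is_ideal _ (point_gens v) k).
have /choice[B BP] i : exists B, coef_ideal (ideal_pow (point_gens v) k)
    (p i - map_poly (@mpolyC n K) (('X - a%:P) ^+ (m - k).+1) * B).
  rewrite rmorphXn rmorphB /= map_polyX map_polyC /=.
  have [c [r [lecm Sr ->]]] := products_adjoin (Tp i).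
  have [lt_c|ge_c] := ltnP (m - k) c.
    exists (('X - a%:MP%:P) ^+ (c - (m - k).+1) * r%:P).
    by rewrite mulrA -exprD subnKC // subrr.
  exists 0; rewrite mulr0 subr0; apply: JM => j; rewrite coefC.
  case: eqP => _; last by case: (@ideal_pow_is_ideal _ (point_gens v) k).
  apply: (@ideal_pow_leq _ _ (m - c)); first by lia.
  exact: ideal_pow_products.
exists (\sum_i u i * B i); rewrite mulr_sumr -sumrB.
apply: is_ideal_sum => [|i _]; first exact/coef_ideal_is_ideal/ideal_pow_is_ideal.
by rewrite mulrCA -mulrBr; apply: JM.
Qed.

End PointMultiplicity.

(** Induction on the number of variables.  Let [e] be the degree of [f] in the
    last variable and [k = m - e %/ #|K|].  Modulo the polynomials of order [k]
    at a point [v], [f] is a multiple of all [('X - a) ^+ (m - k).+1], hence of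
    their product, whose degree [#|K| * (m - k).+1] is greater than [e].
    Therefore [f] is zero modulo these polynomials.  So its leading coefficient,
    a form of degree [d - e], vanishes to order [k] at all [v], and the
    induction hypothesis yields [#|K| * k <= d - e]. *)
Lemma homog_multiplicity_leq (K : finFieldType) (n m d : nat)
    (f : {mpoly K[n.+1]}) : f != 0 -> f \is d.-homog ->
    (forall v, v ord0 = 1 -> ideal_pow (point_gens v) m f) ->
  (#|K| * m <= d)%N.
Proof.
elim: n m d f => [|n IHn] m d f f_neq0 hf ptf.
  case: m ptf => [|m] ptf; first by rewrite muln0.
  have f1 : f.@[fun=> 1] = 0.
    have [k [a [p [Sp ->]]]] := ptf (fun=> 1) erefl.
    rewrite raddf_sum big1 //= => i _; have [g [Sg ->]] := Sp i.
    rewrite big_ord_recl !mevalM; have [j ->] := Sg ord0.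
    by rewrite mevalB mevalXU mevalC subrr mul0r mulr0.
  case/eqP: f_neq0; apply/mpolyP => u; rewrite mcoeff0.
  have [degu|/(dhomog_nemf_coeff hf)//] := eqVneq (mdeg u) d.
  have uniq_mon (u' : 'X_{1..1}) : mdeg u' = d -> u' = u.
    rewrite -degu !mdegE !big_ord1 => E; apply/mnmP => i.
    by rewrite ord1.
  have fE : f = f@_u *: 'X_[u].
    apply/mpolyP => u'; rewrite mcoeffZ mcoeffX; case: eqP => [->|neq].
      by rewrite mulr1.
    rewrite mulr0; apply: (dhomog_nemf_coeff hf); apply/eqP => /uniq_mon E.
    by case: neq.
  move: f1; rewrite {1}fE mevalZ mevalX big1 ?mulr1 //.
  by move=> i _; rewrite expr1n.
have F_neq0 := muni_neq0 f_neq0.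
set F := muni f in F_neq0; pose e := (size F).-1.
have lead_neq0 : F`_e != 0 by rewrite -/(lead_coef F) lead_coef_eq0.
have [le_ed h_lead] := coef_muni_homog hf lead_neq0.
have [le_m|lt_m] := leqP m (e %/ #|K|).
  by apply: leq_trans le_ed; rewrite mulnC -leq_divRL //; apply/card_gt0P; exists 0.
suff : (#|K| * (m - e %/ #|K|) <= d - e)%N.
  have := leq_trunc_div e #|K|; move: #|K| (e %/ _)%N le_ed => c t.
  rewrite [(t * c)%N]mulnC mulnBr => le_ed le_ct; rewrite leq_subLR.
  by move/leq_trans; apply; rewrite -[leqRHS](subnKC le_ed) leq_add2r.
apply: (IHn _ _ F`_e) => // v v0.
set k := (m - _)%N.
have : coef_ideal (ideal_pow (point_gens v) k) F; last by apply.
have idP := @ideal_pow_is_ideal _ (point_gens v) k.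
apply: (@coef_ideal_small _ _ (@mpolyC n.+1 K) _
         (\prod_(a <- enum K) ('X - a%:P) ^+ (m - k).+1)) => //.
- by apply: monic_prod => a _; apply: monic_exp; apply: monicXsubC.
- rewrite big_enum /= size_prod => [|a _]; last first.
    by rewrite expf_neq0 // polyXsubC_eq0.
  rewrite (eq_bigr (fun=> (m - k).+2)) => [|a _]; last by rewrite size_exp_XsubC.
  rewrite sum_nat_const.
  have -> : (m - k)%N = (e %/ #|K|)%N by rewrite /k subKn // ltnW.
  have Kgt0 : (0 < #|K|)%N by apply/card_gt0P; exists 0.
  have -> : size F = e.+1 by rewrite /e prednK // size_poly_gt0.
  rewrite mulnS -addnS addKn ltnS mulnC mulSn addnC {1}(divn_eq e #|K|).
  by rewrite ltn_add2l ltn_mod.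
- apply: congruent_multiple_prod => //; first exact: enum_uniq.
  move=> a _; apply: congruent_multiple_muni; first by rewrite leq_subr.
  move=> w wv wa; apply: ptf; rewrite -v0 -wv; congr w.
  exact: val_inj.
Qed.

(** * Forms on the points of a finite projective space *)

Section FiniteField.
Variable K : finFieldType.
Local Notation s := #|K|.

Lemma card_gt1 : (1 < s)%N.
Proof. exact: finNzRing_gt1. Qed.

Lemma expf_card_pred (x : K) : x ^+ s.-1 = (x != 0)%:R.
Proof.
case: eqVneq => [->|x_neq0]; first by rewrite expr0n -subn1 subn_eq0 leqNgt card_gt1.
by apply: (mulfI x_neq0); rewrite -exprS prednK ?expf_card ?mulr1 // ltnW ?card_gt1.
Qed.

Lemma natr_card_eq0 : s%:R = 0 :> K.
Proof.
have := @expg_cardG _ [set: K]%G (1%R : K) (finset.in_setT _).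
by rewrite cardsT FinRing.zmodXgE FinRing.zmod1gE.
Qed.

(** The sum is multiplied by [g ^+ k != 1] under the substitution of [g * a] for
    [a]. *)
Lemma sum_expf_eq0 k : (k < s.-1)%N -> \sum_(a : K) a ^+ k = 0.
Proof.
have [->|k_gt0 ltk] := posnP k.
  by rewrite (eq_bigr (fun=> 1)) // sumr_const -natr_card_eq0.
have [g g_neq0 gk] : exists2 g : K, g != 0 & g ^+ k != 1.
  apply/exists_inP; rewrite -[X in is_true X]negbK negb_exists_in.
  apply/negP => /forall_inP gk; move: ltk; rewrite ltnNge => /negP[].
  have p_neq0 : 'X^k - 1 != 0 :> {poly K} by rewrite -size_poly_gt0 size_XnsubC.
  have roots : all (root ('X^k - 1)) (enum (predC1 (0 : K))).
    apply/allP => x; rewrite mem_enum => /gk; rewrite negbK => /eqP xk.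
    by rewrite rootE !hornerE xk subrr.
  have := max_poly_roots p_neq0 roots (enum_uniq _).
  by rewrite size_XnsubC // ltnS -cardE cardC1.
apply/eqP; rewrite -(mulrI_eq0 _ (mulfI (_ : g ^+ k - 1 != 0))) ?subr_eq0 //.
rewrite mulrBl mul1r mulr_sumr subr_eq0; apply/eqP.
rewrite [RHS](reindex_inj (mulfI g_neq0)).
by apply: eq_bigr => a _; rewrite exprMn.
Qed.

(** In a monomial of degree less than [n * s.-1] the exponent of some variable is
    less than [s.-1]. *)
Lemma sum_meval_eq0 n (f : {mpoly K[n]}) :
  (msize f <= n * s.-1)%N -> \sum_(v : {ffun 'I_n -> K}) f.@[v] = 0.
Proof.
move=> szf; under eq_bigr do rewrite mevalE.
rewrite exchange_big big_seq big1 //= => m /msize_mdeg_lt ltm.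
rewrite -mulr_sumr -(bigA_distr_bigA (fun i a => a ^+ m i)).
have /existsP[i lti] : [exists i, m i < s.-1]%N.
  rewrite -[X in is_true X]negbK negb_exists; apply/negP => /forallP gem.
  have := leq_trans ltm szf; rewrite mdegE ltnNge => /negP[].
  rewrite -[X in (X * _)%N]card_ord -sum_nat_const; apply: leq_sum => i _.
  by rewrite leqNgt gem.
by rewrite (bigD1 i) //= sum_expf_eq0 // mul0r mulr0.
Qed.

End FiniteField.

Definition proportional (K : fieldType) n (v q : 'I_n -> K) :=
  exists a, v =1 fun i => a * q i.

Lemma meval_scale (R : comNzRingType) n d (f : {mpoly R[n]}) a (v : 'I_n -> R) :
  f \is d.-homog -> f.@[fun i => a * v i] = a ^+ d * f.@[v].
Proof.
move=> hf; rewrite !mevalE mulr_sumr big_seq [RHS]big_seq; apply: eq_bigr => m fm.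
rewrite -(dhomog_mf hf fm) /= mdegE -prodrXr mulrCA -big_split /=.
by congr (_ * _); apply: eq_bigr => i _; rewrite exprMn.
Qed.

Lemma dhomog_msize_leq (R : nzRingType) n d (f : {mpoly R[n]}) :
  f \is d.-homog -> (msize f <= d.+1)%N.
Proof.
move=> hf; rewrite mmeasureE big_seq; elim/big_ind: _ => // [a b|m fm].
  by rewrite geq_max => -> ->.
by rewrite /= (dhomog_mf hf fm).
Qed.

Section FiniteProjectiveSpace.
Variables (K : finFieldType) (n : nat).
Local Notation s := #|K|.
Implicit Types (p q v : 'I_n.+1 -> K) (f : {mpoly K[n.+1]}).

(** The sum of the values of a polynomial of small degree over the affine space
    [K^(n + 1)] is zero.  For the product of [f] with the power of ['X_i] that
    has degree [n * s.-1], only the line of [q] contributes, and its nonzero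
    points all contribute the same value since [s.-1] divides the degree. *)
Lemma one_point_degree_geq q d f : (0 < n)%N -> (exists i, q i != 0) ->
    f \is d.-homog -> (forall v, ~ proportional v q -> f.@[v] = 0) ->
    f.@[q] != 0 ->
  (n * s.-1 + 1 <= d)%N.
Proof.
move=> n_gt0 [i qi] hf f0 fq; rewrite leqNgt addn1 ltnS; apply/negP => le_d.
pose g := f * 'X_i ^+ (n * s.-1 - d).
have hg : g \is (n * s.-1).-homog.
  rewrite -[(n * s.-1)%N](subnKC le_d); apply: dhomogM => //.
  by rewrite -[X in X.-homog]mul1n; apply: dhomogMn; rewrite dhomogX /= mdeg1.
have gq : g.@[q] != 0.
  by rewrite mevalM rmorphXn /= mevalXU mulf_neq0 // expf_neq0.
have s_gt1 := card_gt1 K.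
have sum_g : \sum_(v : {ffun 'I_n.+1 -> K}) g.@[v] = 0.
  apply: sum_meval_eq0; apply: leq_trans (dhomog_msize_leq hg) _.
  by rewrite mulSn -add1n leq_add2r; case: (s) s_gt1 => [|[]].
pose line a : {ffun 'I_n.+1 -> K} := [ffun j => a * q j].
have line_inj : injective line.
  by move=> a b /ffunP/(_ i); rewrite !ffunE => /(mulIf qi).
apply/eqP: sum_g; rewrite (bigID (mem [set line a | a in K]%SET)) /=.
rewrite [X in _ + X]big1 ?addr0; last first.
  move=> v vNline; rewrite mevalM f0 ?mul0r // => -[a va].
  case/negP: vNline; apply/imsetP; exists a => //.
  by apply/ffunP => j; rewrite ffunE va.
rewrite big_imset /=; last by move=> a b _ _; apply: line_inj.
rewrite (eq_bigr (fun a => a ^+ (n * s.-1) * g.@[q])) => [|a _]; last first.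
  by rewrite -(meval_scale _ _ hg); apply: meval_eq => j; rewrite ffunE.
rewrite -mulr_suml mulf_neq0 //.
rewrite (eq_bigr (fun a => (a != 0)%:R)) => [|a _]; last first.
  rewrite mulnC exprM expf_card_pred; case: (a != 0); rewrite ?expr1n //.
  by rewrite expr0n gtn_eqF.
rewrite (bigD1 0) //= eqxx add0r (eq_bigr (fun=> 1)) => [|a ->//].
rewrite (eq_bigl (mem (predC1 0))) // sumr_const cardC1.
by rewrite -subn1 natrB ?(ltnW s_gt1) // natr_card_eq0 sub0r oppr_eq0 oner_eq0.
Qed.

(** With linear forms [lam] and [mu] that are coordinates on the line [p q], the
    form [lam ^+ s.-1 - mu ^+ s.-1] is nonzero at a point of this line exactly
    if the point is [p] or [q], and then [lam ^+ s.-1 + mu ^+ s.-1] is one.  The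
    forms [c i] vanish together exactly on the line, and two of them, with indices
    [i0] and [i1], are zero. *)
Lemma separator_exists p q : (exists i, q i != 0) -> ~ proportional p q ->
  exists E : {mpoly K[n.+1]}, [/\ E \is (n * s.-1).-homog, E.@[p] = 1 &
    forall v, ~ proportional v p -> ~ proportional v q -> E.@[v] = 0].
Proof.
move=> [i0 qi0] npq; pose t := s.-1.
have [i1 Dneq0] : exists i, p i * q i0 - p i0 * q i != 0.
  apply/existsP; rewrite -[X in is_true X]negbK negb_exists; apply/negP => /forallP D0.
  apply: npq; exists (p i0 / q i0) => i; have := D0 i; rewrite negbK subr_eq0 => /eqP E.
  by apply: (mulIf qi0); rewrite E mulrAC divfK.
set D := _ - _ in Dneq0.
have i10 : i1 != i0 by apply: contraNneq Dneq0 => E; rewrite /D E mulrC subrr.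
pose lam : {mpoly K[n.+1]} := D^-1 *: (q i0 *: 'X_i1 - q i1 *: 'X_i0).
pose mu : {mpoly K[n.+1]} := (q i0)^-1 *: ('X_i0 - p i0 *: lam).
pose c i : {mpoly K[n.+1]} := 'X_i - p i *: lam - q i *: mu.
have hX i : ('X_i : {mpoly K[n.+1]}) \is 1.-homog by rewrite dhomogX /= mdeg1.
have hlam : lam \is 1.-homog by do !(apply: dhomogZ || apply: rpredB || exact: hX).
have hmu : mu \is 1.-homog by do !(apply: dhomogZ || apply: rpredB || exact: hX).
have hc i : c i \is 1.-homog by do !(apply: dhomogZ || apply: rpredB || exact: hX).
have lamE v : lam.@[v] = (q i0 * v i1 - q i1 * v i0) / D.
  by rewrite mevalZ mevalB !mevalZ !mevalXU mulrC.
have muE v : mu.@[v] = (v i0 - p i0 * lam.@[v]) / q i0.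
  by rewrite mevalZ mevalB !mevalZ !mevalXU mulrC.
have cE i v : (c i).@[v] = v i - p i * lam.@[v] - q i * mu.@[v].
  by rewrite !mevalB !mevalZ !mevalXU.
have lamp : lam.@[p] = 1.
  by rewrite lamE (_ : _ - _ = D) ?divff // /D; ring.
have mup : mu.@[p] = 0 by rewrite muE lamp mulr1 subrr mul0r.
have ci0 v : (c i0).@[v] = 0.
  by rewrite cE muE mulrCA divff // mulr1 subrr.
have ci1 v : (c i1).@[v] = 0.
  have lamD : q i0 * v i1 = lam.@[v] * D + q i1 * v i0.
    by rewrite lamE divfK // subrK.
  have muD : v i0 = mu.@[v] * q i0 + p i0 * lam.@[v] by rewrite muE divfK // subrK.
  apply: (mulfI qi0); rewrite mulr0 cE !mulrBr lamD {1}muD /D; ring.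
pose F := \prod_(i | (i != i0) && (i != i1)) (lam ^+ t + mu ^+ t - c i ^+ t).
have hpow l : l \is 1.-homog -> l ^+ t \is t.-homog.
  by move=> /(dhomogMn t); rewrite mul1n.
have hF : F \is (n.-1 * t).-homog.
  have -> : (n.-1 * t = \sum_(i < n.+1 | (i != i0) && (i != i1)) t)%N.
    have := cardsC [set i0; i1]%SET; rewrite cards2 eq_sym i10 card_ord => -[cardC].
    rewrite sum_nat_const -[in LHS]cardC; congr (_ * _)%N; apply: eq_card => i.
    by rewrite !inE negb_or.
  rewrite /F; elim/big_rec2: _ => [|i m f _ hf]; first exact: dhomog1.
  by apply: dhomogM => //; apply: rpredB; [apply: rpredD|]; apply: hpow.
have n_gt0 : (0 < n)%N.
  case: (posnP n) => // n0; case/eqP: i10; apply: val_inj => /=.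
  by have := ltn_ord i0; have := ltn_ord i1; lia.
exists ((lam ^+ t - mu ^+ t) * F); split.
- have -> : (n * s.-1 = t + n.-1 * t)%N by rewrite -mulSn prednK.
  by apply: dhomogM => //; apply: rpredB; apply: hpow.
- have t_gt0 : (0 < t)%N by rewrite /t -subn1 subn_gt0 card_gt1.
  rewrite mevalM mevalB !rmorphXn /= lamp mup expr1n expr0n gtn_eqF // subr0 mul1r.
  rewrite rmorph_prod big1 //= => i _; rewrite mevalB mevalD !rmorphXn /=.
  rewrite cE lamp mup mulr1 mulr0 subr0 subrr expr1n expr0n gtn_eqF //.
  by rewrite addr0 subr0.
- move=> v nvp nvq; rewrite mevalM mevalB !rmorphXn /= !expf_card_pred.
  have [lam0|lam_neq0] := eqVneq lam.@[v] 0; have [mu0|mu_neq0] := eqVneq mu.@[v] 0;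
    rewrite ?subrr ?mul0r //.
  all: suff -> : F.@[v] = 0 by rewrite mulr0.
  all: rewrite rmorph_prod /=; apply/eqP/prodf_eq0.
  all: have [/existsP[i ci]|/existsPn c0] := boolP [exists i, (c i).@[v] != 0].
  1,3: exists i; first by
    apply/andP; split; apply: contraNneq ci => ->; rewrite ?ci0 ?ci1.
  1,2: rewrite mevalB mevalD !rmorphXn /= !expf_card_pred ci;
    rewrite ?lam0 ?mu0 ?eqxx ?lam_neq0 ?mu_neq0 ?add0r ?addr0 subrr //.
  + case: nvq; exists mu.@[v] => i; have := c0 i; rewrite negbK cE lam0 mulr0 subr0.
    by rewrite subr_eq0 mulrC => /eqP.
  + case: nvp; exists lam.@[v] => i; have := c0 i; rewrite negbK cE mu0 mulr0 subr0.
    by rewrite subr_eq0 mulrC => /eqP.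
Qed.

End FiniteProjectiveSpace.

Section Multiplicities.
Variables (K : finFieldType) (n : nat).
Local Notation s := #|K|.
Implicit Types (p q v : 'I_n.+1 -> K) (f : {mpoly K[n.+1]}).

(** The linear forms [x_i0 + \sum_j a_j * (q_i0 * x_j - q_j * x_i0)] are those
    with the value [q_i0] at [q], each of them listed [s] times since [a_i0] has
    the coefficient zero.  Those that vanish at [p] correspond to the solutions
    [a] of one nontrivial affine linear equation. *)
Lemma hyperplanes_off_point q : (exists i, q i != 0) ->
  exists G : {mpoly K[n.+1]}, [/\ G \is (s ^ n.+1).-homog, G.@[q] != 0 &
    forall p, ~ proportional p q -> ideal_pow (linear_forms_at p) (s ^ n) G].
Proof.
move=> [i0 qi0].
pose z v j := q i0 * v j - q j * v i0.
pose l (a : {ffun 'I_n.+1 -> K}) : {mpoly K[n.+1]} :=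
  'X_i0 + \sum_j a j *: (q i0 *: 'X_j - q j *: 'X_i0).
have lE a v : (l a).@[v] = v i0 + \sum_j a j * z v j.
  rewrite mevalD mevalXU [X in _ + X]raddf_sum /=; congr (_ + _).
  by apply: eq_bigr => j _; rewrite mevalZ mevalB !mevalZ !mevalXU.
have hX i : ('X_i : {mpoly K[n.+1]}) \is 1.-homog by rewrite dhomogX /= mdeg1.
have hl a : l a \is 1.-homog.
  apply: rpredD => //; apply: rpred_sum => j _.
  by do !(apply: dhomogZ || apply: rpredB || exact: hX).
have hprod (A : {set {ffun 'I_n.+1 -> K}}) : \prod_(a in A) l a \is #|A|.-homog.
  rewrite -sum1_card; elim/big_rec2: _ => [|a k f _ hf]; first exact: dhomog1.
  by rewrite (addnC 1%N) -[X in X.-homog]addnC; apply: dhomogM.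
exists (\prod_a l a); split.
- have := hprod [set: {ffun 'I_n.+1 -> K}]%SET.
  by rewrite cardsT card_ffun card_ord big_set /=.
- rewrite rmorph_prod; apply/prodf_neq0 => a _.
  by rewrite /= lE big1 ?addr0 // => j _; rewrite /z [q i0 * _]mulrC subrr mulr0.
move=> p npq.
have [j0 zj0] : exists j, z p j != 0.
  apply/existsP; rewrite -[X in is_true X]negbK negb_exists; apply/negP => /forallP z0.
  apply: npq; exists (p i0 / q i0) => i.
  have := z0 i; rewrite negbK subr_eq0 => /eqP E.
  by apply: (mulfI qi0); rewrite E mulrC mulrA (mulrC (q i0)) divfK.
pose A c := [set a : {ffun 'I_n.+1 -> K} | \sum_j a j * z p j == c]%SET.
have cardA c : #|A c| = #|A 0|.
  pose shift (a : {ffun 'I_n.+1 -> K}) : {ffun 'I_n.+1 -> K} :=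
    [ffun j => a j + (if j == j0 then c / z p j0 else 0)].
  have shiftE (a : {ffun 'I_n.+1 -> K}) :
      \sum_j shift a j * z p j = \sum_j a j * z p j + c.
    under eq_bigr do rewrite ffunE mulrDl.
    rewrite big_split /=; congr (_ + _); rewrite (bigD1 j0) //= eqxx divfK // big1.
      by rewrite addr0.
    by move=> j /negPf->; rewrite mul0r.
  have shift_inj : injective shift.
    by move=> a b E; apply/ffunP => j; have /ffunP/(_ j) := E; rewrite !ffunE => /addIr.
  have [shift' shiftK shift'K] := injF_bij shift_inj.
  rewrite -[RHS](card_imset _ shift_inj); apply: eq_card => a; rewrite !inE.
  apply/eqP/imsetP => [Ea|[b]]; last first.
    by rewrite inE => /eqP Eb ->; rewrite shiftE Eb add0r.
  exists (shift' a); rewrite ?shift'K // inE -(inj_eq (addIr c)) -shiftE shift'K.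
  by rewrite Ea add0r.
have cardA0 : #|A (- p i0)| = (s ^ n)%N.
  apply/eqP; rewrite -(eqn_pmul2l (ltnW (card_gt1 K))) -expnS cardA.
  have <- : #|{ffun 'I_n.+1 -> K}| = (s ^ n.+1)%N by rewrite card_ffun card_ord.
  rewrite -[X in _ == X]sum1_card.
  rewrite (partition_big (fun a : {ffun _ -> _} => \sum_j a j * z p j) predT) //=.
  rewrite -[X in (X * _)%N]sum1_card big_distrl /=; apply/eqP; apply: eq_bigr => c _.
  by rewrite mul1n -(cardA c) -sum1_card; apply: eq_bigl => a; rewrite inE.
rewrite (bigID (mem (A (- p i0)))) /=.
apply: is_idealMr; first exact: ideal_pow_is_ideal.
rewrite -cardA0 big_enum_val /=; apply: ideal_pow_prod => i; split=> //.
by have := enum_valP i; rewrite inE lE => /eqP->; rewrite subrr.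
Qed.

(** The points with first coordinate one avoid [q] after a change of
    coordinates which moves a hyperplane through [q] to the first coordinate
    hyperplane. *)
Lemma multiplicity_degree_geq q m d f : (0 < n)%N -> (exists i, q i != 0) ->
    f != 0 -> f \is d.-homog ->
    (forall v, ~ proportional v q -> ideal_pow (linear_forms_at v) m f) ->
  (s * m <= d)%N.
Proof.
move=> n_gt0 [i qi] f_neq0 hf ptf.
have [q0|q0] := eqVneq (q ord0) 0.
  apply: (homog_multiplicity_leq f_neq0 hf) => v v0.
  apply: ideal_pow_point (ptf v _) => [g []//|[a va]].
  by move/eqP: v0; rewrite va q0 mulr0 eq_sym oner_eq0.
have lt1n : (1 < n.+1)%N by []; pose i1 := Ordinal lt1n.
pose c := q i1 / q ord0.
pose h := [tuple (if i == ord0 then 'X_i1 else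
  if i == i1 then 'X_ord0 + c *: 'X_i1 else 'X_i : {mpoly K[n.+1]}) | i < n.+1].
pose h' := [tuple (if i == ord0 then 'X_i1 - c *: 'X_ord0 else
  if i == i1 then 'X_ord0 else 'X_i : {mpoly K[n.+1]}) | i < n.+1].
have comp_h i' : 'X_i' \mPo h = tnth h i' by rewrite comp_mpolyXU -tnth_nth.
have comp_h' i' : 'X_i' \mPo h' = tnth h' i' by rewrite comp_mpolyXU -tnth_nth.
have hK g : (g \mPo h) \mPo h' = g.
  pose id0 : set {mpoly K[n.+1]} := [set 0].
  have id0P : is_ideal id0.
    by split=> [//|_ _ -> ->|a _ ->]; rewrite /id0 /= ?addr0 ?mulr0.
  apply/eqP; rewrite -subr_eq0; apply/eqP.
  apply: (@rmorph_mod_ideal _ _ _ (comp_mpoly h' \o comp_mpoly h) idfun id0) => //.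
    by move=> a; rewrite /= !comp_mpolyC.
  move=> j; rewrite /id0 /= comp_h tnth_mktuple; case: eqVneq => [->|j0].
    by rewrite comp_h' tnth_mktuple subrr.
  case: eqVneq => [->|j1]; last first.
    by rewrite comp_h' tnth_mktuple (negPf j0) (negPf j1) subrr.
  by rewrite comp_mpolyD comp_mpolyZ !comp_h' !tnth_mktuple /= subrK subrr.
have hh j : tnth h j \is 1.-homog.
  rewrite tnth_mktuple; do 2?case: ifP => _; rewrite ?dhomogX /= ?mdeg1 //.
  by apply: rpredD; [|apply: dhomogZ]; rewrite dhomogX /= mdeg1.
have hfh : f \mPo h \is d.-homog.
  rewrite comp_mpolyEX big_seq; apply: rpred_sum => u fu; apply: dhomogZ.
  rewrite comp_mpolyX -(dhomog_mf hf fu) /= mdegE.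
  elim/big_rec2: _ => [|j x k _ hk]; first exact: dhomog1.
  by apply: dhomogM => //; rewrite -[X in X.-homog]mul1n; apply: dhomogMn.
apply: (@homog_multiplicity_leq K n m d (f \mPo h)) => //.
  by apply: contra_neq f_neq0 => fh; rewrite -(hK f) fh comp_mpoly0.
move=> v v0; pose w j := (tnth h j).@[v].
apply: (@ideal_pow_point _ _ _ [set g | g.@[v] = 0]) => //.
apply: (@ideal_pow_rmorph _ _ (comp_mpoly h) (linear_forms_at w)).
  by move=> g [_ gw] /=; rewrite comp_mpoly_meval.
apply: ptf => -[a wa]; have := wa ord0; have := wa i1.
rewrite /w !tnth_mktuple /= mevalD mevalZ !mevalXU v0 => E1 E0.
move: E1; rewrite E0 mulrCA divfK // -[RHS]add0r => /addIr/eqP.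
by rewrite oner_eq0.
Qed.

End Multiplicities.

(** * Ideals of points *)

Section ProjectivePoints.
Variables (K : fieldType) (N : nat).
Implicit Types (p q : proj_point K N) (f : {mpoly K[N.+1]}).

Definition coords p : 'I_N.+1 -> K := vpick (sval p) 0.

Lemma coords_neq0 p : exists i, coords p i != 0.
Proof.
apply/existsP; rewrite -[X in is_true X]negbK negb_exists; apply/negP => /forallP p0.
have : vpick (sval p) = 0.
  by apply/rowP => i; rewrite mxE; apply/eqP; have := p0 i; rewrite negbK.
by move/eqP; rewrite vpick0 -dimv_eq0 (eqP (svalP p)).
Qed.

Lemma proj_point_line p : sval p = <[vpick (sval p)]>%VS.
Proof.
apply/esym/eqP; rewrite eqEdim -memvE memv_pick (eqP (svalP p)) dim_vline.
by rewrite vpick0 -dimv_eq0 (eqP (svalP p)).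
Qed.

Lemma mem_proj_point p (v : 'rV[K]_N.+1) :
  v \in sval p -> proportional (v 0) (coords p).
Proof.
rewrite proj_point_line => /vlineP[a ->]; exists a => i.
by rewrite mxE.
Qed.

Lemma proportional_coords p q : proportional (coords p) (coords q) -> p = q.
Proof.
move=> [a pa]; apply/val_inj/eqP.
rewrite /= eqEdim (eqP (svalP p)) (eqP (svalP q)) andbT.
rewrite (proj_point_line p) -memvE (_ : vpick _ = a *: vpick (sval q)).
  by rewrite memvZ // memv_pick.
by apply/rowP => i; rewrite mxE -[LHS]/(coords p i) pa.
Qed.

Lemma proj_point_of (v : 'I_N.+1 -> K) : (exists i, v i != 0) ->
  exists2 p, proportional v (coords p) & proportional (coords p) v.
Proof.
move=> [i vi]; pose u : 'rV[K]_N.+1 := \row_j v j.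
have u_neq0 : u != 0.
  by apply: contra_neq vi => /rowP/(_ i); rewrite !mxE.
have du : \dim <[u]>%VS == 1%N by rewrite dim_vline u_neq0.
exists (exist _ <[u]>%VS du).
  have [|a ua] := @mem_proj_point (exist _ <[u]>%VS du) u; first exact: memv_line.
  by exists a => j; rewrite -ua mxE.
have /vlineP[a au] := memv_pick <[u]>%VS.
by exists a => j; rewrite /coords /= au !mxE.
Qed.

Lemma vanishes_atE d f p : f \is d.-homog -> vanishes_at f p <-> f.@[coords p] = 0.
Proof.
move=> hf; split=> [fp|fp v vp _].
  apply: fp; first exact: memv_pick.
  by rewrite vpick0 -dimv_eq0 (eqP (svalP p)).
have [a va] := mem_proj_point vp.
by rewrite (meval_eq _ va) (meval_scale _ _ hf) fp mulr0.
Qed.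

(** Modulo the linear forms that vanish at [v], all variables are multiples of
    one of them, so that a form is congruent to a multiple of its value at [v]. *)
Lemma homog_vanishing_linear d f (v : 'I_N.+1 -> K) : (exists i, v i != 0) ->
  f \is d.-homog -> f.@[v] = 0 -> ideal_gen (linear_forms_at v) f.
Proof.
move=> [i0 vi0] hf fv.
pose h := [tuple (v j / v i0) *: ('X_i0 : {mpoly K[N.+1]}) | j < N.+1].
have fh0 : f \mPo h = 0.
  rewrite comp_mpolyEX.
  rewrite (eq_big_seq
    (fun m => (f@_m * \prod_j (v j / v i0) ^+ m j) *: 'X_i0 ^+ d)).
    rewrite -scaler_suml -mevalE (meval_eq _ (_ : _ =1 fun j => (v i0)^-1 * v j)).
      by rewrite (meval_scale _ _ hf) fv mulr0 scale0r.
    by move=> j; rewrite mulrC.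
  move=> m fm; rewrite comp_mpolyX -scalerA; congr (_ *: _).
  rewrite (eq_bigr (fun j => (v j / v i0) ^+ m j *: 'X_i0 ^+ m j)) => [|j _];
    last by rewrite tnth_mktuple exprZn.
  by rewrite scaler_prod prodrXr -mdegE (dhomog_mf hf fm).
rewrite -[f]subr0 -fh0.
apply: (@rmorph_mod_ideal _ _ _ idfun (comp_mpoly h)) => [|c|j].
- exact: ideal_gen_is_ideal.
- by rewrite /= comp_mpolyC.
- apply: sub_ideal_gen; rewrite /= comp_mpolyXU -tnth_nth tnth_mktuple; split.
    by apply: rpredB; [|apply: dhomogZ]; rewrite dhomogX /= mdeg1.
  by rewrite mevalB mevalZ !mevalXU divfK // subrr.
Qed.

Lemma ideal_pow_point_linear p m f : ideal_pow (points_ideal [set p]) m f ->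
  ideal_pow (linear_forms_at (coords p)) m f.
Proof.
move=> Ipf; apply: (@ideal_pow_gen _ (linear_forms_at (coords p))).
- exact: ideal_pow_is_ideal.
- exact: ideal_pow_products.
apply: ideal_powS Ipf; apply: ideal_gen_min; first exact: ideal_gen_is_ideal.
move=> g [[d hg] gp]; apply: (homog_vanishing_linear (coords_neq0 p) hg).
by apply/(vanishes_atE _ hg)/gp.
Qed.

Lemma linear_ideal_pow_point p m f : ideal_pow (linear_forms_at (coords p)) m f ->
  ideal_pow (points_ideal [set p]) m f.
Proof.
apply: ideal_powS => l [hl lp]; apply: sub_ideal_gen; split; first by exists 1%N.
by move=> _ ->; apply/(vanishes_atE _ hl).
Qed.

Lemma pihomog_ideal_pow_linear (v : 'I_N.+1 -> K) m k f :
  ideal_pow (linear_forms_at v) m f ->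
  ideal_pow (linear_forms_at v) m (pihomog mdeg k f).
Proof.
move=> [j [a [g [lg ->]]]]; rewrite raddf_sum.
apply: is_ideal_sum => [|i _]; first exact: ideal_pow_is_ideal.
have [l [lv gE]] := lg i.
have hg : g i \is m.-homog.
  suff : \prod_(b < m) l b \is (\sum_(b < m) 1).-homog by rewrite gE sum1_card card_ord.
  elim/big_rec2: _ => [|b x y _ hy]; first exact: dhomog1.
  by apply: dhomogM => //; case: (lv b).
have [P0 _ PM] := @ideal_pow_is_ideal _ (linear_forms_at v) m.
rewrite /= (pihomog_mulr _ _ hg); case: ifP => // _.
by apply/PM/ideal_pow_products/lg.
Qed.

Lemma ideal_pow_linear_proportional (v w : 'I_N.+1 -> K) m f :
    proportional w v -> ideal_pow (linear_forms_at v) m f ->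
  ideal_pow (linear_forms_at w) m f.
Proof.
move=> [a wa]; apply: ideal_powS => l [hl lv]; split=> //.
by rewrite (meval_eq _ wa) (meval_scale _ _ hl) lv mulr0.
Qed.

End ProjectivePoints.

Section AllButOnePoint.
Variables (K : finFieldType) (N : nat) (q : proj_point K N).
Hypothesis N_gt0 : (0 < N)%N.
Local Notation s := #|K|.
Local Notation X := (~` [set q]).
Local Notation D := (N * s.-1 + 1)%N.
Implicit Types (p : proj_point K N) (f : {mpoly K[N.+1]}).

Lemma symbolic_pow_linear m f (v : 'I_N.+1 -> K) : symbolic_pow X m f ->
  ~ proportional v (coords q) -> ideal_pow (linear_forms_at v) m f.
Proof.
move=> If nvq; have [|p vp pv] := @proj_point_of K N v.
  apply/existsP; rewrite -[X in is_true X]negbK negb_exists; apply/negP => /forallP v0.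
  by apply: nvq; exists 0 => i; have := v0 i; rewrite negbK mul0r => /eqP.
apply: (ideal_pow_linear_proportional vp); apply/ideal_pow_point_linear/If.
by move=> /= pq; apply: nvq; rewrite -pq.
Qed.

Lemma linear_symbolic_pow m f :
    (forall v, ~ proportional v (coords q) -> ideal_pow (linear_forms_at v) m f) ->
  symbolic_pow X m f.
Proof.
move=> If p pq; apply/linear_ideal_pow_point/If.
by move=> /proportional_coords.
Qed.

Lemma symbolic_pow_degree_geq m d f :
  f != 0 -> f \is d.-homog -> symbolic_pow X m f -> (s * m <= d)%N.
Proof.
move=> f_neq0 hf If.
apply: (multiplicity_degree_geq N_gt0 (coords_neq0 q) f_neq0 hf) => v.
exact: symbolic_pow_linear.
Qed.

(** The nonzero homogeneous components of an element have degree at least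
    [s * m], which exceeds [r * D], and [X] has separators of degree [D - 1]. *)
Lemma symbolic_pow_sub m r : (r * D < s * m)%N ->
  symbolic_pow X m `<=` ideal_pow (points_ideal X) r.
Proof.
move=> lt_rm f If; rewrite [f](pihomog_partitionE (leqnn (msize f))).
apply: is_ideal_sum => [|k _]; first exact: ideal_pow_is_ideal.
set g := pihomog mdeg k f.
have hg : g \is k.-homog by apply: pihomogP.
have gv v : ~ proportional v (coords q) -> ideal_pow (linear_forms_at v) m g.
  by move=> /(symbolic_pow_linear If); apply: pihomog_ideal_pow_linear.
have [->|g_neq0] := eqVneq g 0.
  by case: (@ideal_pow_is_ideal _ (points_ideal X) r).
have le_k : (r * D <= k)%N.
  apply: leq_trans (ltnW lt_rm) _; apply: (symbolic_pow_degree_geq g_neq0 hg).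
  exact: linear_symbolic_pow.
have le_rm : (r <= m)%N.
  have s_gt0 : (0 < s)%N := ltnW (card_gt1 K).
  rewrite -(leq_pmul2l s_gt0) mulnC; apply: leq_trans (ltnW lt_rm).
  rewrite leq_mul2l -{1}(prednK s_gt0) -addn1 leq_add2r.
  by rewrite leq_pmull ?orbT.
(* The type of points is not a finite type, but that of vectors is. *)
pose Y := {v : 'rV[K]_N.+1 | `[< exists2 p, p <> q & v 0 = coords p >]}.
pose pt (y : Y) : 'I_N.+1 -> K := val y 0.
have ptP y : exists2 p, p <> q & pt y = coords p by have /asboolP := valP y.
have pt_npq y : ~ proportional (pt y) (coords q).
  by have [p pq ->] := ptP y => /proportional_coords.
have /choice[E EP] y : exists E : {mpoly K[N.+1]}, [/\ E \is (N * s.-1).-homog,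
    E.@[pt y] = 1 & forall v, ~ proportional v (pt y) ->
      ~ proportional v (coords q) -> E.@[v] = 0].
  exact: (separator_exists (coords_neq0 q)).
have E_pt y z : (E y).@[pt z] = (y == z)%:R.
  have [_ E1 E0] := EP y; case: eqVneq => [<-//|yz]; apply: E0 => //.
  have [p _ yp] := ptP y; have [p' _ zp'] := ptP z.
  rewrite zp' yp => /proportional_coords pp'; case/eqP: yz; apply/val_inj/rowP => i.
  by rewrite -/(pt y) -/(pt z) yp zp' pp'.
have pt_neq0 y : exists i, pt y i != 0.
  by have [p _ ->] := ptP y; apply: coords_neq0.
have E_homog y : E y \is (N * s.-1).-homog by case: (EP y).
have le_k' : (r * (N * s.-1).+1 <= k)%N by rewrite -(addn1 (N * s.-1)).
have g_pow y : ideal_pow (linear_forms_at (pt y)) r g.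
  by apply: ideal_pow_leq le_rm _ _; apply/gv.
have := symbolic_pow_large_degree pt_neq0 E_homog E_pt le_k' hg g_pow.
apply: ideal_powS => f' [hf' f'0].
apply: sub_ideal_gen; split; first by exists (N * s.-1).+1.
move=> p pq; apply/(vanishes_atE _ hf').
have /asboolP yP : exists2 p', p' <> q & vpick (sval p) 0 = coords p' by exists p.
exact: (f'0 (Sub (vpick (sval p)) yP)).
Qed.

(** Along the line of [q], an element of the ideal vanishes to order at least
    [D] at the origin, since forms of smaller degree in the ideal vanish at [q].
    So the elements of the power vanish there to order [r * D]. *)
Lemma ideal_pow_degree_geq r d f : f \is d.-homog -> f.@[coords q] != 0 ->
  ideal_pow (points_ideal X) r f -> (r * D <= d)%N.
Proof.
move=> hf fq If.
pose line : {rmorphism {mpoly K[N.+1]} -> {poly K}} :=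
  mmap polyC (fun i => coords q i *: 'X).
have lineE e g : g \is e.-homog -> line g = g.@[coords q] *: 'X^e.
  move=> hg; rewrite /line /= /mmap mevalE scaler_suml.
  rewrite big_seq [RHS]big_seq; apply: eq_bigr => m gm.
  rewrite /mmap1 (eq_bigr (fun i => coords q i ^+ m i *: 'X ^+ m i)) => [|i _];
    last by rewrite exprZn.
  by rewrite scaler_prod prodrXr -mdegE (dhomog_mf hg gm) mul_polyC scalerA.
pose J := [set g | 'X^(r * D) %| line g].
suff Jf : J f.
  move: Jf; rewrite /J /= (lineE _ _ hf) dvdpZr // => /dvdp_leq.
  by rewrite !size_polyXn ltnS; apply; rewrite monic_neq0 ?monicXn.
apply: (@ideal_pow_gen _ _ J r) If => [|_ [g [Sg ->]]].
  split=> [|g1 g2|a g]; rewrite /J /= ?rmorph0 ?dvdp0 // ?rmorphD ?rmorphM.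
    exact: dvdp_add.
  exact: dvdp_mull.
rewrite /J /= rmorph_prod mulnC exprM -[r in _ ^+ r]card_ord -prodr_const.
elim/big_rec2: _ => [|i x y _ xy]; first exact: dvdpp.
apply: dvdp_mul => //; have [[e hg] g0] := Sg i.
rewrite (lineE _ _ hg); have [->|gq] := eqVneq (g i).@[coords q] 0.
  by rewrite scale0r dvdp0.
rewrite dvdpZr // dvdp_exp2l //.
apply: (one_point_degree_geq N_gt0 (coords_neq0 q) hg _ gq) => v nvq.
have [|p vp pv] := @proj_point_of K N v.
  apply/existsP; rewrite -[X in is_true X]negbK negb_exists; apply/negP => /forallP v0.
  by apply: nvq; exists 0 => j; have := v0 j; rewrite negbK mul0r => /eqP.
have [a va] := vp; rewrite (meval_eq _ va) (meval_scale _ _ hg).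
rewrite (iffLR (vanishes_atE p hg)) ?mulr0 //; apply: g0.
by move=> /= pq; apply: nvq; rewrite -pq.
Qed.

Lemma symbolic_pow_hyperplanes t : exists G : {mpoly K[N.+1]},
  [/\ symbolic_pow X (s ^ N * t) G, G \is (s ^ N.+1 * t).-homog &
      G.@[coords q] != 0].
Proof.
have [G [hG Gq IG]] := hyperplanes_off_point (coords_neq0 q).
exists (G ^+ t); split; last by rewrite rmorphXn expf_neq0.
  by apply: linear_symbolic_pow => v nvq; apply: ideal_powX; apply: IG.
exact: dhomogMn.
Qed.

Lemma symbolic_pow_not_sub t r : (s ^ N.+1 * t < r * D)%N ->
  ~ (symbolic_pow X (s ^ N * t)%N `<=` ideal_pow (points_ideal X) r).
Proof.
have [G [IG hG Gq]] := symbolic_pow_hyperplanes t.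
by move=> lt_t /(_ G IG)/(ideal_pow_degree_geq hG Gq); rewrite leqNgt lt_t.
Qed.

End AllButOnePoint.

(** * The asymptotic invariants *)

Lemma least_degreeP (K : fieldType) n (J : set {mpoly K[n]}) d (f : {mpoly K[n]}) :
    J f -> f != 0 -> f \is d.-homog ->
  exists2 g, [/\ J g, g != 0 & g \is (least_degree J).-homog] &
    (least_degree J <= d)%N.
Proof.
move=> Jf f_neq0 hf.
pose has_degree (k : nat) := exists f : {mpoly K[n]}, [/\ J f, f != 0 & f \is k.-homog].
have exd : exists k, `[< has_degree k >] by exists d; apply/asboolP; exists f.
have [k /asboolP k_deg k_min] := ex_minnP exd.
rewrite /least_degree; case: xgetP => [e _ [[g gP] e_min]|none].
  by exists g => //; apply: e_min; exists f.
by case: (none k); split=> // e e_deg; apply: k_min; apply/asboolP.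
Qed.

Section Limits.
Variable R : realType.

(** The fractions differ from [D / s] by [D / s / (s * c * T + 1)]. *)
Lemma ereal_sup_fractions (s D c : nat) (A : set (\bar R)) :
    (0 < s)%N -> (0 < D)%N -> (0 < c)%N ->
    (forall T, (0 < T)%N ->
       A ((c * (T * D))%:R / (s * c * T + 1)%:R)%:E) ->
  ((D%:R / s%:R)%:E <= ereal_sup A)%E.
Proof.
move=> s_gt0 D_gt0 c_gt0 AT; apply/lee_subgt0Pr => e e_gt0.
pose T := (Num.truncn ((D%:R / s%:R : R) / e)).+1.
have T_gt : (D%:R / s%:R : R) / e < T%:R by apply: truncnS_gt.
apply: le_trans (ereal_sup_ubound (AT T isT)).
rewrite -EFinB lee_fin; set u := (s * c * T + 1)%N.
have u_gt0 : 0 < u%:R :> R by rewrite ltr0n /u addn1.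
have s_neq0 : s%:R != 0 :> R by rewrite pnatr_eq0 -lt0n.
have -> : (c * (T * D))%:R / u%:R = D%:R / s%:R - D%:R / s%:R / u%:R :> R.
  rewrite /u natrD !natrM; field.
  by rewrite s_neq0 -!natrM natr1 pnatr_eq0.
rewrite lerD2l lerN2 ler_pdivrMr // [e * _]mulrC -ler_pdivrMr //.
apply: le_trans (ltW T_gt) _; rewrite ler_nat /u.
apply: leq_trans (leq_pmull T (_ : 0 < s * c)%N) (leq_addr _ _).
by rewrite muln_gt0 s_gt0.
Qed.

Lemma limn_ratio (s c : nat) (a : nat -> nat) :
    (forall m, (s * m <= a m)%N) -> (forall m, (a m <= s * m + c)%N) ->
  limn (fun m : nat => (a m)%:R / m%:R : R) = s%:R.
Proof.
move=> a_ge a_le; apply: cvg_lim => //; rewrite -cvg_shiftS.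
apply: (@squeeze_cvgr _ _ _ _ (fun=> s%:R) (fun m => s%:R + c%:R * harmonic m)).
- near=> m; have m_gt0 : 0 < m.+1%:R :> R by rewrite ltr0n.
  rewrite /= ler_pdivlMr // -natrM ler_nat a_ge /=.
  rewrite ler_pdivrMr // mulrDl -mulrA mulVf ?gt_eqF // mulr1 -natrM -natrD ler_nat.
  exact: a_le.
- exact: cvg_cst.
- rewrite -[X in _ --> X]addr0 -[X in _ + X](mulr0 c%:R).
  by apply: cvgD; [exact: cvg_cst|apply: cvgMr; exact: cvg_harmonic].
Unshelve. all: by end_near.
Qed.

End Limits.

Theorem theorem3p2 (R : realType) (K : finFieldType) (s : nat)
    (hs : #|K| = s) (N : nat) (hN : (2 <= N)%N) (q : proj_point K N) :
  let X : set (proj_point K N) := ~` [set q] in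
  [/\ resurgence R X = ((N%:R * (s%:R - 1) + 1) / s%:R)%:E,
      asymptotic_resurgence R X = ((N%:R * (s%:R - 1) + 1) / s%:R)%:E &
      waldschmidt R X = s%:R].
Proof.
move=> X; have N_gt0 : (0 < N)%N := ltnW hN.
have s_gt1 : (1 < s)%N by rewrite -hs card_gt1.
have s_gt0 := ltnW s_gt1.
pose D := (N * s.-1 + 1)%N.
have -> : N%:R * (s%:R - 1) + 1 = D%:R :> R.
  by rewrite /D natrD natrM -subn1 natrB.
have res_le : (resurgence R X <= (D%:R / s%:R)%:E)%E.
  apply: ge_ereal_sup => _ [m [r [m_gt0 r_gt0 not_sub ->]]].
  rewrite lee_fin ler_pdivrMr ?ltr0n // mulrAC ler_pdivlMr ?ltr0n // -!natrM ler_nat.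
  rewrite leqNgt; apply/negP => lt_r; apply: not_sub.
  by apply: symbolic_pow_sub => //; rewrite hs mulnC [(s * m)%N]mulnC.
have asym_le : (asymptotic_resurgence R X <= resurgence R X)%E.
  apply: ge_ereal_sup => _ [m [r [m_gt0 r_gt0 [T _ not_sub] ->]]].
  apply: ereal_sup_ubound; exists (m * T.+1)%N, (r * T.+1)%N; split.
  - by rewrite muln_gt0 m_gt0.
  - by rewrite muln_gt0 r_gt0.
  - by apply: not_sub => /=.
  - by rewrite !natrM -mulf_div divff ?mulr1 ?pnatr_eq0.
have le_asym : ((D%:R / s%:R)%:E <= asymptotic_resurgence R X)%E.
  apply: (@ereal_sup_fractions R s D (s ^ N)) => [//||| T T_gt0].
  - by rewrite /D addn1.
  - by rewrite expn_gt0 s_gt0.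
  (* [r] is the least integer with [s ^ N.+1 * t < r * D] for [t = T * D]. *)
  exists (s ^ N * (T * D))%N, (s * s ^ N * T + 1)%N; split=> //.
  - by rewrite !muln_gt0 expn_gt0 s_gt0 T_gt0 /D addn1.
  - by rewrite addn1.
  exists 1%N => // t /= t_gt0; rewrite -mulnA -hs.
  apply: symbolic_pow_not_sub => //; rewrite hs -/D expnS.
  have -> : ((s * s ^ N * T + 1) * t * D = s * s ^ N * (T * D * t) + t * D)%N by ring.
  by rewrite -[X in (X < _)%N]addn0 ltn_add2l muln_gt0 t_gt0 /D addn1.
split.
- by apply/eqP; rewrite eq_le res_le (le_trans le_asym asym_le).
- by apply/eqP; rewrite eq_le le_asym (le_trans asym_le res_le).
have least_degree_bounds m : exists2 g : {mpoly K[N.+1]},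
    [/\ symbolic_pow X m g, g != 0 & g \is (least_degree (symbolic_pow X m)).-homog] &
    (least_degree (symbolic_pow X m) <= s ^ N.+1 * (m %/ s ^ N).+1)%N.
  have [G [IG hG Gq]] := symbolic_pow_hyperplanes q (m %/ s ^ N).+1.
  rewrite hs in IG hG; apply: (@least_degreeP _ _ _ _ G) => //.
    move=> p pq; apply: ideal_pow_leq (IG p pq).
    by rewrite mulnC ltnW // ltn_ceil // expn_gt0 s_gt0.
  by apply: contraNneq Gq => ->; rewrite meval0.
apply: (@limn_ratio R s (s ^ N.+1)) => m;
  have [g [Ig g_neq0 hg] le_m] := least_degree_bounds m.
  by rewrite -{1}hs; apply: symbolic_pow_degree_geq g_neq0 hg Ig.
apply: leq_trans le_m _; rewrite mulnS addnC leq_add2r expnS -mulnA leq_mul2l.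
by rewrite mulnC leq_trunc_div orbT.
Qed.
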